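(* Let $A$ be a unital FDI (equivalently, unital liminal) $C^*$-algebra, let $S \subset A$ be an operator system with $\dim(S) < \infty$ and let $\varphi: S \to B(H)$ be a unital completely positive map with $\dim(H) < \infty$. Then $\varphi$ dilates to a finite-dimensional representation of $A$; that is, there exist a finite-dimensional Hilbert space $K \supset H$ and a unital $*$-homomorphism $\pi: A \to B(K)$ such that $\varphi(s) = P_H \pi(s)|_H$ for all $s \in S$.
   Context: A $C^*$-algebra is called FDI if all of its irreducible representations are finite-dimensional; for unital $C^*$-algebras this is the same as being liminal (CCR). An operator system in a unital $C^*$-algebra $A$ is a self-adjoint linear subspace $S \subset A$ containing the unit of $A$. A unital completely positive map $\varphi : S \to B(H)$ is a unital linear map all of whose entrywise amplifications $\varphi^{(n)} : M_n(S) \to M_n(B(H))$ are positive. $K \supset H$ means that $H$ is a subspace of the Hilbert space $K$, and $P_H$ is the orthogonal projection of $K$ onto $H$. *)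

(* Defs.v *)
From HB Require Import structures.
From mathcomp Require Import all_boot all_order all_algebra.
From mathcomp Require Import complex.
From mathcomp Require Import all_classical all_reals.
From mathcomp Require Import topology normedtype.

Set Implicit Arguments.
Unset Strict Implicit.
Unset Printing Implicit Defensive.

Import Order.TTheory GRing.Theory Num.Theory.
Import numFieldNormedType.Exports.

Local Open Scope classical_set_scope.
Local Open Scope ring_scope.

(* Norms of complex normed spaces take values in R[i]; they are nonnegative
   there, hence real.  The multiplication is part of this mixin because
   Hierarchy Builder rejects a join of the library's (semi)rings and normed
   modules (numDomainType already inherits from both a semiring and a normed
   Z-module).  The zero algebra is allowed. *)
HB.mixin Record isCStarAlgebra (R : realType) A
    & CompleteNormedModule R[i] A := {
  cone : A;
  cmul : A -> A -> A;
  star : A -> A;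
  cmulA : associative cmul;
  cmul1l : left_id cone cmul;
  cmul1r : right_id cone cmul;
  cmulDl : left_distributive cmul +%R;
  cmulDr : right_distributive cmul +%R;
  cmulZl : forall (c : R[i]) (a b : A), cmul (c *: a) b = c *: cmul a b;
  cmulZr : forall (c : R[i]) (a b : A), cmul a (c *: b) = c *: cmul a b;
  cnormM : forall a b : A, `|cmul a b| <= `|a| * `|b|;
  starK : involutive star;
  starD : forall a b : A, star (a + b) = star a + star b;
  starZ : forall (c : R[i]) (a : A), star (c *: a) = c^* *: star a;
  starM : forall a b : A, star (cmul a b) = cmul (star b) (star a);
  cnorm_star : forall a : A, `|cmul (star a) a| = `|a| ^+ 2
}.

#[short(type="cstarAlgType")]
HB.structure Definition CStarAlgebra (R : realType) :=
  {A of CompleteNormedModule R[i] A & isCStarAlgebra R A}.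

Arguments cone {R} A : rename.

(* The ring underlying A, as an alias of A on which the library's ring
   operations and matrix products are available. *)
Definition cstar_ring (R : realType) (A : cstarAlgType R) : Type := A.

Section CStarRing.
Variables (R : realType) (A : cstarAlgType R).

HB.instance Definition _ := GRing.Lmodule.copy (cstar_ring A) A.
HB.instance Definition _ := GRing.Zmodule_isPzRing.Build (cstar_ring A)
  (@cmulA R A) (@cmul1l R A) (@cmul1r R A) (@cmulDl R A) (@cmulDr R A).

End CStarRing.

HB.mixin Record isHilbert (R : realType) H & CompleteNormedModule R[i] H := {
  hdot : {dot H for Num.conj};
  hnormE : forall x : H, `|x| ^+ 2 = hdot x x
}.

#[short(type="hilbertType")]
HB.structure Definition Hilbert (R : realType) :=
  {H of CompleteNormedModule R[i] H & isHilbert R H}.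

Notation "''[' x , y ]" := (hdot x y) (format "''[' x ,  y ]") : ring_scope.

#[short(type="boundedOpType")]
HB.structure Definition BoundedOp (R : realType) (H K : hilbertType R) :=
  {T of @GRing.Linear R[i] H K *:%R T & @Continuous H K T}.

Notation "''B' ( H )" := (boundedOpType H H) (format "''B' ( H )") : type_scope.

Section LinearSubspaces.
Variables (R : realType) (V : lmodType R[i]).

Definition subspace (W : set V) : Prop :=
  W 0 /\ forall (c : R[i]) (x y : V), W x -> W y -> W (c *: x + y).

Definition finite_dim (W : set V) : Prop :=
  exists (n : nat) (e : 'I_n -> V), (forall i, W (e i)) /\
    forall x, W x -> exists c : 'I_n -> R[i], x = \sum_(i < n) c i *: e i.

End LinearSubspaces.

Section OrthogonalProjection.
Variables (R : realType) (K : hilbertType R).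

Definition orth_proj (W : set K) (P : 'B(K)) : Prop :=
  forall x, W (P x) /\ forall w, W w -> '[x - P x, w] = 0.

End OrthogonalProjection.

Section Representations.
Variables (R : realType) (A : cstarAlgType R) (H : hilbertType R).

Record representation (pi : A -> 'B(H)) : Prop := {
  repr_linear : forall (c : R[i]) (a b : A) (x : H),
    pi (c *: a + b) x = c *: pi a x + pi b x;
  repr_mul : forall (a b : A) (x : H), pi (cmul a b) x = pi a (pi b x);
  repr_one : forall x : H, pi (cone A) x = x;
  repr_star : forall (a : A) (x y : H), '[pi (star a) x, y] = '[x, pi a y]
}.

Definition irreducible (pi : A -> 'B(H)) : Prop :=
  (exists x : H, x != 0) /\
  forall W : set H, subspace W -> closed W ->
    (forall (a : A) (x : H), W x -> W (pi a x)) -> W = [set 0] \/ W = setT.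

End Representations.

Definition fdi (R : realType) (A : cstarAlgType R) : Prop :=
  forall (H : hilbertType R) (pi : A -> 'B(H)),
    representation pi -> irreducible pi -> finite_dim [set: H].

Section Positivity.
Variable R : realType.

Definition star_mx (A : cstarAlgType R) (n : nat) (b : 'M[cstar_ring A]_n) :
  'M[cstar_ring A]_n := map_mx (star : A -> A) b^T.

Definition mx_pos (A : cstarAlgType R) (n : nat) (a : 'M[cstar_ring A]_n) :
  Prop := exists b : 'M[cstar_ring A]_n, a = star_mx b *m b.

(* Positivity of an n x n matrix of operators on H as an operator on H^n. *)
Definition opmx_pos (H : hilbertType R) (n : nat) (T : 'M['B(H)]_n) : Prop :=
  forall x : 'I_n -> H, 0 <= \sum_(i < n) '[\sum_(j < n) T i j (x j), x i].

End Positivity.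

Section OperatorSystems.
Variables (R : realType) (A : cstarAlgType R).

Record operator_system (S : set A) : Prop := {
  opsys_subspace : subspace S;
  opsys_star : forall a, S a -> S (star a);
  opsys_one : S (cone A)
}.

(* A map S -> B(H) is represented by a map on A of which only the values on S
   matter; its n-th amplification is map_mx phi. *)
Record ucp (H : hilbertType R) (S : set A) (phi : A -> 'B(H)) : Prop := {
  ucp_linear : forall (c : R[i]) (a b : A) (x : H), S a -> S b ->
    phi (c *: a + b) x = c *: phi a x + phi b x;
  ucp_one : forall x : H, phi (cone A) x = x;
  ucp_pos : forall (n : nat) (s : 'M[A]_n), (forall i j, S (s i j)) ->
    mx_pos s -> opmx_pos (map_mx phi s)
}.

End OperatorSystems.

(* Main.v *)
Require Import Defs.
From HB Require Import structures.
From mathcomp Require Import all_boot all_order all_algebra.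
From mathcomp Require Import complex.
From mathcomp Require Import all_classical all_reals.
From mathcomp Require Import topology normedtype.
From mathcomp Require Import ring lra.

Set Implicit Arguments.
Unset Strict Implicit.
Unset Printing Implicit Defensive.

Import Order.TTheory GRing.Theory Num.Theory.
Import numFieldNormedType.Exports.

Local Open Scope classical_set_scope.
Local Open Scope ring_scope.

(** Let [e_1, ..., e_n] span [H].  The matrix of functionals
    [a |-> '[phi a (e_j), e_i]] is one positive functional [f] on [M_n(S)].
    On [M_n(A)], ordered by the sums of hermitian squares, the unit matrix is an
    order unit, and [M_n(S)] is finite-dimensional, so [f] is a finite
    nonnegative combination of restrictions of pure states of [M_n(A)].  The GNS
    space of such a state is built here directly over [A], as the completion of
    [A^n] with the form [(v, w) |-> F (w^* v)]; purity makes the representation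
    of [A] on it irreducible, hence finite-dimensional because [A] is FDI.  The
    GNS space of the sum of these states is then finite-dimensional, and its
    vectors [xi_j], the classes of the standard basis of [A^n], satisfy
    ['[pi a (xi_j), xi_i] = '[phi a (e_j), e_i]] for [a] in [S]; sending [e_j] to
    [xi_j] is the isometry [V]. *)

(** * Pure states on an ordered vector space with an order unit *)

(** The decomposition never extends [f] first. It picks a pure state in the face of those states
    whose restriction lies in the span of the face generated by [f], subtracts as much of it as
    positivity allows, and recurses on a face of smaller dimension. Finite dimension of the span is
    what makes the combination finite and replaces Carathéodory's theorem; the extension of [f] to
    [M_n(A)] is a by-product.

    No norm on [M_n(A)] enters. The norm of [A] is used only to show that [s - a^* a] is a hermitian
    square in [A] for large [s], which gives both the order unit of [M_n(A)] and the boundedness of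
    the GNS action. Taking [A^n] as the GNS module produces a representation of [A] itself, to which
    the FDI hypothesis applies directly.

    The sum of the pure states is not realised on a direct sum of their GNS spaces: the null space
    of its form contains the intersection of finitely many null spaces of finite codimension, which
    bounds the dimension of its own GNS space. *)

Section Infima.
Variable R : realType.
Implicit Types (E F G : set R) (c : R).

Lemma inf_leD E F G : E !=set0 -> F !=set0 -> has_lbound G ->
  (forall a b, E a -> F b -> exists2 c, G c & c <= a + b) ->
  inf G <= inf E + inf F.
Proof.
move=> E0 F0 lG EFG; rewrite -lerBlDr; apply: lb_le_inf => // a Ea.
rewrite lerBlDl -lerBlDr; apply: lb_le_inf => // b Fb.
have [c Gc cab] := EFG _ _ Ea Fb.
by rewrite lerBlDl (le_trans _ cab)//; exact: ge_inf.
Qed.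

Lemma inf_leZ E G c : 0 <= c -> E !=set0 -> has_lbound G ->
  (forall a, E a -> exists2 b, G b & b <= c * a) -> inf G <= c * inf E.
Proof.
rewrite le_eqVlt => /predU1P[<-|c0] E0 lG EG.
  by case: E0 => a /EG[b Gb]; rewrite !mul0r; apply: le_trans; exact: ge_inf.
rewrite mulrC -ler_pdivrMr//; apply: lb_le_inf => // a /EG[b Gb ba].
by rewrite ler_pdivrMr// mulrC (le_trans _ ba)//; exact: ge_inf.
Qed.

End Infima.

(** * Sublinear functionals as support functions *)

Section Sublinear.
Variables (R : realType) (X : lmodType R).
Implicit Types (p : X -> R) (x y : X).

Definition sublinear p :=
  (forall x y, p (x + y) <= p x + p y) /\
  (forall c x, 0 <= c -> p (c *: x) <= c * p x).

Lemma sublinear_ge0 p : sublinear p -> 0 <= p 0.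
Proof. by move=> [+ _] => /(_ 0 0); rewrite addr0 -subr_ge0 addrK. Qed.

Lemma sublinear0 p : sublinear p -> p 0 = 0.
Proof.
move=> sp; apply/le_anti; rewrite sublinear_ge0// andbT.
by have := sp.2 0 0 (lexx _); rewrite scale0r mul0r.
Qed.

Lemma sublinear_oppr p x : sublinear p -> - p (- x) <= p x.
Proof.
move=> sp; rewrite lerNl -subr_ge0 opprK addrC.
by rewrite (le_trans (sublinear_ge0 sp))// -[X in p X](subrr x) sp.1.
Qed.

Lemma sublinearZ p c x : sublinear p -> 0 <= c -> p (c *: x) = c * p x.
Proof.
move=> sp; rewrite le_eqVlt => /predU1P[<-|c0].
  by rewrite scale0r mul0r sublinear0.
apply/le_anti/andP; split; first by rewrite sp.2// ltW.
rewrite -ler_pdivlMl//.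
by rewrite -{1}[x](scalerK (lt0r_neq0 c0)) sp.2// invr_ge0 ltW.
Qed.

Lemma sublinear_scalar p : sublinear p -> (forall x, p (- x) <= - p x) ->
  scalar p.
Proof.
move=> sp pN.
have pNE x : p (- x) = - p x.
  by apply/le_anti; rewrite pN/= lerNl sublinear_oppr.
have pD x y : p (x + y) = p x + p y.
  apply/le_anti; rewrite sp.1/= -lerN2 -pNE opprD (le_trans (sp.1 _ _))//.
  by rewrite !pNE opprD.
move=> c x y; rewrite pD; congr (_ + _).
have [c0|c0] := leP 0 c; first exact: sublinearZ.
have Nc0 : 0 <= - c by rewrite oppr_ge0 ltW.
by rewrite -[c]opprK scaleNr pNE sublinearZ// -mulNr.
Qed.

(* If [p] is the support function of a set of functionals, [push p x] is that of
   the subset on which the value at [x] is maximal, i.e. equal to [p x]. *)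
Definition push p x y := inf [set p (y + t *: x) - t * p x | t in [set t | 0 <= t]].

Lemma push_lbound p x y : sublinear p ->
  has_lbound [set p (y + t *: x) - t * p x | t in [set t | 0 <= t]].
Proof.
move=> sp; exists (- p (- y)) => _ [t /= t0 <-].
rewrite lerBrDr addrC lerBlDr -sublinearZ//.
by rewrite -{1}[t *: x](addrK y) [_ + y]addrC sp.1.
Qed.

Lemma push_le p x y t : sublinear p -> 0 <= t ->
  push p x y <= p (y + t *: x) - t * p x.
Proof. by move=> sp t0; apply: (ge_inf (push_lbound _ _ sp)); exists t. Qed.

Lemma push_set0 p x y : [set p (y + t *: x) - t * p x | t in [set t | 0 <= t]] !=set0.
Proof. by exists (p (y + 0 *: x) - 0 * p x), 0 => /=. Qed.

Lemma sublinear_push p x : sublinear p -> sublinear (push p x).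
Proof.
move=> sp; split=> [y z|c y c0].
- apply: inf_leD; [exact: push_set0|exact: push_set0|exact: push_lbound|].
  move=> _ _ [s /= s0 <-] [t /= t0 <-].
  exists (p (y + z + (s + t) *: x) - (s + t) * p x).
    by exists (s + t) => //=; rewrite addr_ge0.
  rewrite scalerDl addrACA mulrDl opprD [leRHS]addrACA lerD2r; exact: sp.1.
- apply: inf_leZ => //; [exact: push_set0|exact: push_lbound|].
  move=> _ [t /= t0 <-]; exists (p (c *: y + (c * t) *: x) - c * t * p x).
    by exists (c * t) => //=; rewrite mulr_ge0.
  by rewrite mulrBr mulrA lerD2r -scalerA -scalerDr sp.2.
Qed.

End Sublinear.

Section OrderUnit.
Variables (R : realType) (X : lmodType R) (Q : set X) (u : X).
Implicit Types (p : X -> R) (x y : X) (G H : {scalar X}).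

Definition positive (G : X -> R) := forall x, Q x -> 0 <= G x.

Definition pure G :=
  [/\ positive G, G u = 1 &
      forall H, positive H -> positive (fun x => G x - H x) ->
        exists c, forall x, H x = c * G x].

Record order_unit : Prop := {
  cone0 : Q 0;
  coneD : forall x y, Q x -> Q y -> Q (x + y);
  coneZ : forall c x, 0 <= c -> Q x -> Q (c *: x);
  cone_unit : Q u;
  cone_bound : forall x, exists r, Q (r *: u - x)
}.

Hypothesis Qu : order_unit.

Lemma positive_eq0 G : positive G -> G u = 0 -> forall x, G x = 0.
Proof.
move=> Gp Gu0 x; have [r /Gp] := cone_bound Qu x; have [s /Gp] := cone_bound Qu (- x).
rewrite !linearB/= !linearZ/= linearN/= Gu0 !mulr0 !sub0r opprK oppr_ge0 => a b.
by apply/le_anti; rewrite a b.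
Qed.

Definition scalar_of (G : X -> R) (h : scalar G) : {scalar X} :=
  HB.pack G (GRing.isLinear.Build _ _ _ _ G h).

Definition state G := positive G /\ G u = 1.

(* The functionals dominated by [p] form a face of the state space. *)
Definition face p := forall G H s t, state G -> state H -> 0 < s -> 0 < t ->
  s + t = 1 -> (forall x, s * G x + t * H x <= p x) ->
  (forall x, G x <= p x).

(** If a proper mixture of [G] and [H] lies below [push p x], both lie below [p]. The value at [- x]
    with [t = 1] shows that the mixture reaches [p x] at [x], hence so does [G]; then
    [G y = G (y + r *: x) - r * G x] is below every term of the infimum. *)
Lemma face_push p x : sublinear p -> face p -> face (push p x).
Proof.
move=> sp fp G H s t sG sH s0 t0 st1 GHp.
have ple y : push p x y <= p y.
  by have := push_le x y sp (lexx 0); rewrite scale0r addr0 mul0r subr0.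
have GHp' y : s * G y + t * H y <= p y by exact: le_trans (GHp y) (ple y).
have Gp := fp _ _ _ _ sG sH s0 t0 st1 GHp'.
have Hp : forall y, H y <= p y.
  apply: (fp _ _ _ _ sH sG t0 s0); first by rewrite addrC.
  by move=> y; rewrite addrC.
have Gx : p x <= G x.
  have := le_trans (GHp (- x)) (push_le x (- x) sp ler01).
  rewrite scale1r addNr mul1r sublinear0// sub0r !linearN/= !mulrN -opprD lerN2 => h.
  rewrite -(ler_pM2l s0) -(lerD2r (t * p x)) -mulrDl st1 mul1r (le_trans h)//.
  by rewrite lerD2l ler_pM2l.
move=> y; apply: lb_le_inf; first exact: push_set0.
move=> _ [r /= r0 <-]; rewrite lerBrDr (le_trans _ (Gp _))//.
by rewrite linearD linearZ/= lerD2l ler_wpM2l.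
Qed.

(* Zorn on support functions replaces the weak-* compactness argument of
   Krein-Milman: pointwise infima of chains are again sublinear. *)
Lemma minimal_face p0 : sublinear p0 -> face p0 ->
  exists p, [/\ sublinear p, face p, forall x, p x <= p0 x &
    forall q, sublinear q -> face q -> (forall x, q x <= p x) -> forall x, p x <= q x].
Proof.
move=> sp0 fp0.
pose P p := [/\ sublinear p, face p & forall x, p x <= p0 x].
pose T := {p : X -> R | P p}.
(* Reversed order: a maximal element for Zorn is a pointwise minimal support function. *)
pose le (p q : T) := `[< forall x, sval q x <= sval p x >].
have t0 : T by exists p0.
have [] := @ZL_preorder T t0 le.
- by move=> [p hp]; apply/asboolP => x /=.
- move=> p q r /asboolP pq /asboolP qr; apply/asboolP => x.
  exact: le_trans (qr x) (pq x).
- move=> A totA; have [[a Aa]|A0] := pselect (A !=set0); last first.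
    by exists t0 => s As; exfalso; apply: A0; exists s.
  pose V x := [set sval p x | p in A].
  have V0 x : V x !=set0 by exists (sval a x), a.
  have lV x : has_lbound (V x).
    exists (- p0 (- x)) => _ [[p [sp fp pp0]] Ap /= <-].
    by rewrite (le_trans _ (sublinear_oppr x sp))// lerN2.
  have Vle (p : T) x : A p -> inf (V x) <= sval p x.
    by move=> Ap; apply: ge_inf => //; exists p.
  have sq : sublinear (fun x => inf (V x)).
    split=> [x y|c x c0].
      apply: inf_leD => // _ _ [p Ap <-] [q Aq <-].
      have [/asboolP pq|/asboolP qp] := totA _ _ Ap Aq.
        exists (sval q (x + y)); first by exists q.
        by case: (svalP q) => sq _ _; rewrite (le_trans (sq.1 _ _))// lerD2r.
      exists (sval p (x + y)); first by exists p.
      by case: (svalP p) => sp _ _; rewrite (le_trans (sp.1 _ _))// lerD2l.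
    apply: inf_leZ => // _ [p Ap <-].
    exists (sval p (c *: x)); first by exists p.
    by case: (svalP p) => sp _ _; exact: sp.2.
  have fq : face (fun x => inf (V x)).
    move=> G H s t sG sH s0 t_0 st1 GH x; apply: lb_le_inf => // _ [p Ap <-].
    case: (svalP p) => _ fp _; apply: (fp G H s t) => // y.
    exact: le_trans (GH y) (Vle _ _ Ap).
  have qp0 x : inf (V x) <= p0 x.
    by case: (svalP a) => _ _ /(_ x); apply: le_trans; exact: Vle.
  by exists (exist P _ (And3 sq fq qp0)) => s As; apply/asboolP => x /=; exact: Vle.
move=> [p [sp fp pp0]] pmax; exists p; split=> // q sq fq qp.
have hq : forall x, q x <= p0 x by move=> x; exact: le_trans (qp x) (pp0 x).
have /pmax : le (exist P p (And3 sp fp pp0)) (exist P q (And3 sq fq hq)).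
  by apply/asboolP.
by move=> /asboolP.
Qed.

(** By minimality [p] lies below each [push p x], whose value at [- x] is at most [- p x]; this
    inequality makes a sublinear function linear. *)
Lemma face_scalar p0 : sublinear p0 -> face p0 ->
  exists G, (forall x, G x <= p0 x) /\ face G.
Proof.
move=> /minimal_face/[apply] -[p [sp fp pp0 pmin]].
have sc : scalar p.
  apply: sublinear_scalar => // x.
  have := pmin (push p x) (sublinear_push x sp) (face_push sp fp).
  have le y : push p x y <= p y.
    by have := push_le x y sp (lexx 0); rewrite scale0r addr0 mul0r subr0.
  move=> /(_ le) /(_ (- x)) /le_trans; apply.
  apply: (le_trans (push_le x (- x) sp ler01)).
  by rewrite scale1r addNr mul1r sublinear0// sub0r.
by exists (scalar_of sc).
Qed.

(** A splitting [G = H + K] into positive parts is a convex combination of states with weights [H u]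
    and [K u]. As [G] alone is a face, the normalised [H] lies below [G], hence equals it. A part of
    weight 0 vanishes because [u] is an order unit. *)
Lemma pure_face G : state G -> face G -> pure G.
Proof.
move=> [Gp Gu] fG; split=> // H Hp GHp.
have GHs : scalar (fun x => G x - H x).
  by move=> c x y; rewrite [G _]linearP [H _]linearP/= mulrBr addrACA opprD.
pose K := scalar_of GHs.
have Ku : K u = 1 - H u by rewrite -Gu.
have [Hu0|Hu0] := eqVneq (H u) 0.
  by exists 0 => x; rewrite mul0r; exact: positive_eq0.
have [Hu1|Hu1] := eqVneq (H u) 1.
  have Ku0 : K u = 0 by rewrite Ku Hu1 subrr.
  exists 1 => x; rewrite mul1r; apply/esym/eqP; rewrite -subr_eq0; apply/eqP.
  exact: (@positive_eq0 K).
have Hu_gt0 : 0 < H u by rewrite lt_def Hu0 Hp//; exact: cone_unit Qu.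
have Ku_gt0 : 0 < K u.
  by rewrite lt_def Ku subr_eq0 eq_sym Hu1/= -Gu GHp//; exact: cone_unit Qu.
have scZ (L : {scalar X}) c : scalar (fun x => c * L x).
  by move=> a x y; rewrite linearP/= mulrDr mulrCA.
pose H1 := scalar_of (scZ H (H u)^-1); pose K1 := scalar_of (scZ K (K u)^-1).
have sH1 : state H1.
  split=> [x Qx /=|/=]; last by rewrite mulVf.
  by apply: mulr_ge0; [rewrite invr_ge0 ltW|exact: Hp].
have sK1 : state K1.
  split=> [x Qx /=|/=]; last by rewrite -/(K u) mulVf// gt_eqF.
  by apply: mulr_ge0; [rewrite invr_ge0 ltW|exact: GHp].
have H1G : forall x, H1 x <= G x.
  apply: (fG H1 K1 (H u) (K u)) => //; first by rewrite Ku addrCA subrr addr0.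
  move=> x /=; rewrite !mulrA !mulfV ?gt_eqF// !mul1r.
  by rewrite addrCA subrr addr0.
exists (H u) => x; apply: (mulfI (invr_neq0 Hu0)); rewrite mulrA mulVf// mul1r.
apply/le_anti; rewrite (H1G x)/=.
by have := H1G (- x); rewrite !linearN/= lerN2.
Qed.

(** * A pure state vanishing on a given subspace *)

Section FaceOfAnnihilator.
Variable N : set X.
Hypotheses (N0 : N 0) (ND : forall x y, N x -> N y -> N (x + y))
  (NZ : forall c x, N x -> N (c *: x)).
Hypothesis N_bound : forall t m, N m -> Q (t *: u - m) -> 0 <= t.
Hypothesis N_face : forall G H, positive G -> positive H ->
  (forall m, N m -> G m + H m = 0) -> forall m, N m -> G m = 0.

Let V x := [set t | exists2 m, N m & Q (t *: u - x - m)].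
(** The support function of the states that vanish on [N]: by [state_p] and [p_state], a functional
    lies below [p] exactly when it is such a state. [N_bound] keeps the infimum finite. *)
Let p x := inf (V x).

Let V0 x : V x !=set0.
Proof.
have [r Qr] := cone_bound Qu x.
by exists r, 0 => //; rewrite subr0.
Qed.

Let lV x : has_lbound (V x).
Proof.
have [r Qr] := cone_bound Qu (- x); exists (- r) => t [m Nm Qt].
rewrite lerNl -subr_ge0 opprK addrC; apply: (N_bound Nm).
have := coneD Qu Qt Qr; rewrite opprK scalerDl.
rewrite (_ : _ - x - m + _ = t *: u + r *: u - m)//.
by rewrite [LHS]addrC addrA addrACA subrr addr0 [r *: u + _]addrC.
Qed.

Let ple x t m : N m -> Q (t *: u - x - m) -> p x <= t.
Proof. by move=> Nm Qt; apply: ge_inf => //; exists m. Qed.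

Let sublinear_p : sublinear p.
Proof.
split=> [x y|c x c0].
  apply: inf_leD => // s t [m Nm Qm] [n Nn Qn]; exists (s + t) => //.
  exists (m + n); first exact: ND.
  have := coneD Qu Qm Qn.
  by rewrite scalerDl !opprD addrACA [in X in X -> _](addrACA (s *: u)).
apply: inf_leZ => // t [m Nm Qm]; exists (c * t) => //.
exists (c *: m); first exact: NZ.
by rewrite -scalerA -!scalerBr; exact: coneZ.
Qed.

Let state_p G : (forall x, G x <= p x) -> state G /\ forall m, N m -> G m = 0.
Proof.
move=> Gp; split; first split.
- move=> x Qx; rewrite -oppr_le0 -linearN (le_trans (Gp _))//.
  by apply: (ple N0); rewrite scale0r sub0r opprK subr0.
- apply/le_anti; apply/andP; split.
    rewrite (le_trans (Gp _))//; apply: (ple N0).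
    by rewrite scale1r subrr subr0; exact: cone0.
  rewrite -lerN2 -linearN (le_trans (Gp _))//; apply: (ple N0).
  by rewrite scaleN1r opprK addNr subr0; exact: cone0.
- move=> m Nm.
  have h n : N n -> G n <= 0.
    move=> Nn; rewrite (le_trans (Gp _))//.
    apply: (ple (NZ (-1) Nn)); rewrite scale0r sub0r scaleN1r opprK addNr.
    exact: cone0.
  apply/le_anti; rewrite h//= -oppr_le0 -linearN h//.
  by rewrite -scaleN1r; exact: NZ.
Qed.

Let p_state G : state G -> (forall m, N m -> G m = 0) -> forall x, G x <= p x.
Proof.
move=> [Gp Gu] GN x; apply: lb_le_inf => // t [m Nm /Gp].
by rewrite !linearB/= linearZ/= Gu mulr1 (GN m Nm) subr0 subr_ge0.
Qed.

(** [N_face] makes the states vanishing on [N] a face, and an extreme point of a face is extreme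
    among all states. *)
Lemma exists_pure : exists G, pure G /\ forall m, N m -> G m = 0.
Proof.
have [|G [Gp fG]] := face_scalar sublinear_p; last first.
  by have [sG GN] := state_p Gp; exists G; split=> //; exact: pure_face.
move=> G H s t sG sH s0 t0 st1 GHp.
have scZ (L : {scalar X}) c : scalar (fun x => c * L x).
  by move=> a x y; rewrite linearP/= mulrDr mulrCA.
have scD (L M : {scalar X}) : scalar (fun x => L x + M x).
  by move=> a x y; rewrite !linearP/= mulrDr addrACA.
pose G1 := scalar_of (scZ G s); pose H1 := scalar_of (scZ H t).
have [//|_ GHN] := @state_p (scalar_of (scD G1 H1)).
apply: p_state => // m Nm; apply: (mulfI (lt0r_neq0 s0)); rewrite mulr0.
apply: (@N_face G1 H1) => // x Qx /=.
- by apply: mulr_ge0; [exact: ltW|exact: sG.1].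
- by apply: mulr_ge0; [exact: ltW|exact: sH.1].
Qed.

End FaceOfAnnihilator.

End OrderUnit.

(** Take [B] of maximal rank with row space inside [L]: adjoining a vector of [L] outside that row
    space would raise the rank. *)
Lemma row_subspaceP (F : fieldType) d (L : set 'rV[F]_d) : L 0 ->
  (forall a x y, L x -> L y -> L (a *: x + y)) ->
  exists B : 'M[F]_d, forall v, L v <-> (v <= B)%MS.
Proof.
move=> L0 LP.
pose P k := `[< exists2 B : 'M[F]_d, (forall v : 'rV_d, (v <= B)%MS -> L v) & \rank B = k >].
have exP : exists k, P k.
  exists 0; apply/asboolP; exists 0; last exact: mxrank0.
  by move=> v; rewrite submx0 => /eqP ->.
have leP k : P k -> (k <= d)%N by move=> /asboolP[B _ <-]; exact: rank_leq_row.
case: (ex_maxnP exP leP) => k /asboolP[B BL rB] kmax; exists B => v.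
split=> [Lv|]; last exact: BL.
apply: contrapT => /negP vB.
have : P (\rank (B + v)%MS).
  apply/asboolP; exists (B + v)%MS => // w /sub_addsmxP[[w1 w2] -> /=].
  rewrite addrC [w2]mx11_scalar mul_scalar_mx; apply: LP => //.
  by apply: BL; exact: submxMl.
move=> /kmax; rewrite leqNgt -rB; apply/negP/negPn; apply: rank_ltmx.
by rewrite ltmxE addsmxSl addsmx_sub submx_refl (negbTE vB).
Qed.

(** The double annihilator theorem; the columns of [cokermx B] serve as test functionals. *)
Lemma row_annihilatorP (F : fieldType) d (B : 'M[F]_d) (v : 'rV[F]_d) :
  (forall c : 'rV[F]_d, (forall w : 'rV[F]_d, (w <= B)%MS -> w *m c^T = 0) -> v *m c^T = 0) ->
  (v <= B)%MS.
Proof.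
move=> h; rewrite submxE; apply/eqP/matrixP => i j.
have : v *m col j (cokermx B) = 0.
  rewrite -[col j _]trmxK; apply: h => w.
  by rewrite submxE trmxK => /eqP wB; rewrite colE mulmxA wB mul0mx.
by rewrite colE mulmxA -colE => /matrixP/(_ i 0); rewrite [in LHS]mxE => ->; rewrite !mxE.
Qed.

(** * Decomposition of positive functionals on a finite-dimensional subspace *)

Section PureDecomposition.
Variables (R : realType) (X : lmodType R) (Q : set X) (u : X).
Hypothesis Qu : order_unit Q u.
Variables (d : nat) (e : 'I_d -> X) (cu : 'rV[R]_d).

(** The family [e] may be dependent, so a functional on its span is handled as a row [w] paired with
    coefficient rows. Since [Q] contains 0, [pos w] forces [w] to vanish on linear relations. *)
Let E (c : 'rV[R]_d) := \sum_i c 0 i *: e i.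
Hypothesis Ecu : E cu = u.

Let pair (w c : 'rV[R]_d) : R := \sum_i w 0 i * c 0 i.
Let pos (w : 'rV[R]_d) := forall c, Q (E c) -> 0 <= pair w c.
Let res (G : {scalar X}) : 'rV[R]_d := \row_i G (e i).
(* The linear span of the face generated by [w] in the dual cone. *)
Let L (w h : 'rV[R]_d) := exists k, [/\ 0 <= k, pos (k *: w + h) & pos (k *: w - h)].

Let EP a c c' : E (a *: c + c') = a *: E c + E c'.
Proof.
rewrite /E scaler_sumr -big_split/=; apply: eq_bigr => i _.
by rewrite !mxE scalerDl scalerA.
Qed.

Let pairPr w a c c' : pair w (a *: c + c') = a * pair w c + pair w c'.
Proof.
rewrite /pair mulr_sumr -big_split/=; apply: eq_bigr => i _.
by rewrite !mxE mulrDr mulrCA.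
Qed.

Let pairPl w a c c' : pair (a *: c + c') w = a * pair c w + pair c' w.
Proof.
rewrite /pair mulr_sumr -big_split/=; apply: eq_bigr => i _.
by rewrite !mxE mulrDl mulrA.
Qed.

Let pair0r w : pair w 0 = 0.
Proof. by rewrite /pair big1// => i _; rewrite mxE mulr0. Qed.

Let pair0l w : pair 0 w = 0.
Proof. by rewrite /pair big1// => i _; rewrite mxE mul0r. Qed.

Let pairZl w a c : pair (a *: c) w = a * pair c w.
Proof. by rewrite -[_ *: c]addr0 pairPl pair0l addr0. Qed.

Let pairE w c : w *m c^T = (pair w c)%:M.
Proof.
apply/matrixP => i j; rewrite !ord1 !mxE mulr1n /pair; apply: eq_bigr => k _.
by rewrite mxE.
Qed.

Let pair_res G c : pair (res G) c = G (E c).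
Proof.
rewrite /pair /E linear_sum/=; apply: eq_bigr => i _.
by rewrite linearZ/= mxE mulrC.
Qed.

Let posD w w' : pos w -> pos w' -> pos (w + w').
Proof.
by move=> h h' c Qc; rewrite -[w]scale1r pairPl mul1r addr_ge0 ?h ?h'.
Qed.

Let posZ a w : 0 <= a -> pos w -> pos (a *: w).
Proof.
by move=> a0 h c Qc; rewrite pairZl mulr_ge0// h.
Qed.

Let pos_res (G : {scalar X}) : positive Q G -> pos (res G).
Proof. by move=> Gp c Qc; rewrite pair_res Gp. Qed.

Let L_subspace w : pos w -> L w 0 /\
  forall a x y, L w x -> L w y -> L w (a *: x + y).
Proof.
move=> pw; split.
  by exists 1; rewrite scale1r subr0 addr0.
move=> a x y [k [k0 kp km]] [l [l0 lp lm]].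
exists (`|a| * k + l); split; first by rewrite addr_ge0 ?mulr_ge0.
- rewrite scalerDl addrACA; apply: posD => //; rewrite -scalerA.
  have [a0|a0] := ger0P a; first by rewrite -scalerDr; exact: posZ.
  rewrite -[a in a *: x]opprK [- - a *: x]scaleNr -scalerBr.
  by apply: posZ => //; rewrite oppr_ge0 ltW.
- rewrite scalerDl opprD addrACA; apply: posD => //; rewrite -scalerA.
  have [a0|a0] := ger0P a; first by rewrite -scalerBr; exact: posZ.
  rewrite -[a in a *: x]opprK [- - a *: x]scaleNr opprK -scalerDr.
  by apply: posZ => //; rewrite oppr_ge0 ltW.
Qed.

Let E0 : E 0 = 0.
Proof. by rewrite /E big1// => i _; rewrite mxE scale0r. Qed.

Let EB a c c' : E (a *: c - c') = a *: E c - E c'.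
Proof. by rewrite EP -scaleN1r -[_ *: c' in LHS]addr0 EP E0 addr0 scaleN1r. Qed.

Let pairBr w a c c' : pair w (a *: c - c') = a * pair w c - pair w c'.
Proof.
by rewrite pairPr -[- c']scaleN1r -[_ *: c' in LHS]addr0 pairPr pair0r addr0 mulN1r.
Qed.

Let pairBl w c c' : pair (c - c') w = pair c w - pair c' w.
Proof. by rewrite -[c in LHS]scale1r -scaleN1r pairPl pairZl mul1r mulN1r. Qed.

Let Qcu : Q (E cu). Proof. by rewrite Ecu; exact: cone_unit Qu. Qed.

(* Subtracting the largest possible multiple of a pure state lying in the face
   of [w] lands on the boundary of that face, so its dimension drops. *)
Lemma peel w (B : 'M[R]_d) : pos w -> (forall h, L w h <-> (h <= B)%MS) -> 0 < pair w cu ->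
  exists t G (w' : 'rV[R]_d), [/\ 0 <= t, pure Q u G, w = t *: res G + w', pos w' &
    forall B' : 'M[R]_d, (forall h, L w' h <-> (h <= B')%MS) -> (\rank B' < \rank B)%N].
Proof.
move=> pw LB w0.
(* By the double annihilator, a functional that vanishes on [N] restricts to an element of [L w];
   this is how the pure state is kept in the span of the face of [w]. *)
pose N := [set E c | c in [set c | forall h, L w h -> pair h c = 0]].
have Lw : L w w.
  exists 1; rewrite scale1r subrr; split=> //; first exact: posD.
  by move=> c _; rewrite pair0l.
have N0 : N 0 by exists 0 => // h _; rewrite pair0r.
have NP a x y : N x -> N y -> N (a *: x + y).
  move=> [c hc <-] [c' hc' <-]; exists (a *: c + c') => // h Lh.
  by rewrite pairPr hc// hc'// mulr0 addr0.
have ND x y : N x -> N y -> N (x + y).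
  by move=> Nx Ny; rewrite -[x]scale1r; exact: NP.
have NZ a x : N x -> N (a *: x).
  by move=> Nx; rewrite -[_ *: _]addr0; exact: NP.
have Nb t m : N m -> Q (t *: u - m) -> 0 <= t.
  move=> [c hc <-]; rewrite -Ecu -EB => /pw.
  by rewrite pairBr (hc _ Lw) subr0 pmulr_lge0.
have NL (G : {scalar X}) : (forall m, N m -> G m = 0) -> L w (res G).
  move=> GN; apply/LB/row_annihilatorP => c hc.
  rewrite pairE pair_res GN ?raddf0//; exists c => // h /LB/hc.
  by rewrite pairE => /matrixP/(_ 0 0); rewrite !mxE mulr1n.
(* A multiple of [w] that dominates [G + H] dominates [G], as [H] is positive. *)
have Nf (G H : {scalar X}) : positive Q G -> positive Q H ->
    (forall m, N m -> G m + H m = 0) -> forall m, N m -> G m = 0.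
  move=> Gp Hp GHN.
  have sGH : scalar (fun x => G x + H x).
    by move=> a x y; rewrite !linearP/= mulrDr addrACA.
  have rGH : res (scalar_of sGH) = res G + res H by apply/rowP => i; rewrite !mxE.
  have [k [k0 kp km]] := NL (scalar_of sGH) GHN.
  move=> _ [c hc <-]; rewrite -pair_res; apply: hc; exists k; split=> //.
    by apply: posD; [exact: posZ|exact: pos_res].
  rewrite (_ : _ - _ = k *: w - res (scalar_of sGH) + res H).
    by apply: posD => //; exact: pos_res.
  by rewrite rGH opprD addrA subrK.
have [G [pG GN]] := exists_pure Qu N0 ND NZ Nb Nf.
have Lg := NL _ GN.
have [Gp Gu _] := pG.
(* The multiples of [G] that may be subtracted. They are bounded by the value of [w] at [u], because
   [G u = 1], and the supremum is attained, because each constraint is a closed condition on [t]. *)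
pose T := [set t | 0 <= t /\ pos (w - t *: res G)].
have gu : pair (res G) cu = 1 by rewrite pair_res Ecu.
have posT t c : pos (w - t *: res G) -> Q (E c) -> t * G (E c) <= pair w c.
  move=> h /h; rewrite pairBl pairZl.
  by rewrite subr_ge0 pair_res.
have posT' t : (forall c, Q (E c) -> t * G (E c) <= pair w c) -> pos (w - t *: res G).
  move=> h c /h; rewrite pairBl pairZl.
  by rewrite subr_ge0 pair_res.
have T0 : T 0 by split=> //; rewrite scale0r subr0.
have ubT : has_ubound T.
  by exists (pair w cu) => t [_ /posT/(_ Qcu)]; rewrite Ecu Gu mulr1.
have supT0 : 0 <= sup T by exact: ub_le_sup.
have possup : pos (w - sup T *: res G).
  apply: posT' => c Qc; have : 0 <= G (E c) by exact: Gp.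
  rewrite le_eqVlt => /predU1P[<-|Gc0]; first by rewrite mulr0 pw.
  rewrite -ler_pdivlMr//; apply: ge_sup; first by exists 0.
  by move=> t [_ /posT/(_ Qc)]; rewrite -ler_pdivlMr.
exists (sup T), G, (w - sup T *: res G); split=> //.
  by rewrite addrC subrK.
move=> B' LB'.
apply: rank_ltmx; rewrite ltmxE; apply/andP; split.
  apply/row_subP => i; apply/LB.
  have /LB'[k [k0 kp km]] := row_sub i B'.
  have kw : k *: w = k *: (w - sup T *: res G) + (k * sup T) *: res G.
    by rewrite scalerBr scalerA subrK.
  have ps : pos ((k * sup T) *: res G).
    by apply: posZ; [exact: mulr_ge0|exact: pos_res].
  by exists k; split=> //; rewrite kw addrAC; exact: posD.
apply/negP => BB'.
(* If [res G] were still in the span for the remainder, some multiple [k] of the remainder would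
   dominate it. Then [k = 0] contradicts [G u = 1], and [k > 0] lets a further [k^-1] be subtracted,
   beyond the supremum. *)
have /LB'[k [k0 _ km]] : (res G <= B')%MS by apply: submx_trans BB'; apply/LB.
move: k0; rewrite le_eqVlt => /predU1P[k0|k0].
  move: km; rewrite -k0 scale0r sub0r => /(_ _ Qcu).
  by rewrite -scaleN1r pairZl gu mulr1 oppr_ge0 ler10.
have Tk : T (sup T + k^-1).
  split; first by rewrite addr_ge0// invr_ge0 ltW.
  have := posZ (ltW (_ : 0 < k^-1)) km; rewrite invr_gt0 => /(_ k0).
  by rewrite scalerBr scalerK ?gt_eqF// scalerDl opprD addrA.
have := ub_le_sup ubT Tk; apply/negP; rewrite -ltNge ltrDl invr_gt0//.
Qed.

(** Induction on the dimension of the span of the face. It ends when [w] is 0 at [u]: since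
    [r *: u - E c] lies in [Q] for some [r], [w] is then nonpositive at [c] and at [- c], so it is
    0. *)
Lemma pure_decomposition_row w : pos w ->
  exists m (t : 'I_m -> R) (G : 'I_m -> {scalar X}),
    [/\ forall k, 0 <= t k, forall k, pure Q u (G k) &
       forall i, w 0 i = \sum_k t k * G k (e i)].
Proof.
have LBP w' : pos w' -> exists B : 'M[R]_d, forall h, L w' h <-> (h <= B)%MS.
  by move=> pw'; have [? ?] := L_subspace pw'; exact: row_subspaceP.
move=> pw; have [B LB] := LBP _ pw.
have [n] := ubnP (\rank B); elim: n => // n IHn in w pw B LB *; rewrite ltnS => rB.
have : 0 <= pair w cu by exact: pw.
rewrite le_eqVlt => /predU1P[w0|w0].
  have G0 : 'I_0 -> {scalar X} by case.
  exists 0, (fun=> 0), G0; split=> [[]//|[]//|i].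
  rewrite big_ord0.
  have w_le0 c : pair w c <= 0.
    have [r] := cone_bound Qu (E c); rewrite -Ecu -EB => /pw.
    by rewrite pairBr -w0 mulr0 sub0r oppr_ge0.
  pose c : 'rV[R]_d := delta_mx 0 i.
  have wi : pair w c = w 0 i.
    rewrite /pair (bigD1 i)//= mxE !eqxx mulr1 big1 ?addr0// => j ji.
    by rewrite mxE (negbTE ji) andbF mulr0.
  apply/le_anti; rewrite -wi w_le0/= -oppr_le0.
  by have := w_le0 ((-1) *: c + 0); rewrite pairPr pair0r addr0 mulN1r.
have [t [G [w' [t0 pG ww' pw' rB']]]] := peel pw LB w0.
have [B' LB'] := LBP _ pw'.
have [m [s [H [s0 pH w'E]]]] := IHn _ pw' _ LB' (leq_trans (rB' _ LB') rB).
exists m.+1, (fun k => oapp s t (unlift 0 k)), (fun k => oapp H G (unlift 0 k)).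
split=> [k|k|i].
- by case: unliftP => [j|] _ /=.
- by case: unliftP => [j|] _ /=.
- rewrite big_ord_recl unlift_none/= ww' !mxE w'E; congr (_ + _).
  by apply: eq_bigr => k _; rewrite liftK.
Qed.

End PureDecomposition.

(** The right-hand side is defined on all of [X], so this also serves as the extension theorem for
    positive functionals on the span of [e]. *)
Theorem pure_decomposition (R : realType) (X : lmodType R) (Q : set X) (u : X)
    (d : nat) (e : 'I_d -> X) (w : 'I_d -> R) :
  order_unit Q u -> (exists c : 'I_d -> R, u = \sum_i c i *: e i) ->
  (forall c : 'I_d -> R, Q (\sum_i c i *: e i) -> 0 <= \sum_i c i * w i) ->
  exists m (t : 'I_m -> R) (G : 'I_m -> {scalar X}),
    [/\ forall k, 0 <= t k, forall k, pure Q u (G k) &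
       forall i, w i = \sum_k t k * G k (e i)].
Proof.
move=> Qu [cu uE] wpos.
have [|c Qc|m [t [G [t0 pG wE]]]] :=
    @pure_decomposition_row _ _ _ _ Qu d e (\row_i cu i) _ (\row_i w i).
- by rewrite uE; apply: eq_bigr => i _; rewrite mxE.
- have := wpos (fun i => c 0 i) Qc; congr (_ <= _).
  by apply: eq_bigr => i _; rewrite mxE mulrC.
- by exists m, t, G; split=> // i; rewrite -wE mxE.
Qed.

(** * Completion of a space with a positive semidefinite form *)

Section ComplexLimits.
Variable R : realType.
Implicit Types (x y z e : R[i]).

Lemma posc_real e : 0 < e -> exists2 r : R, 0 < r & e = r%:C%C.
Proof.
by case: e => a b; rewrite ltcE/= => /andP[/eqP -> a0]; exists a.
Qed.

Lemma norm_realc (r : R) : `|r%:C%C| = `|r|%:C%C :> R[i].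
Proof. by rewrite normc_def/= expr0n addr0 sqrtr_sqr. Qed.

Lemma ler_norm_ReIm z : `|z| <= (`|complex.Re z| + `|complex.Im z|)%:C%C.
Proof.
rewrite {1}[z]complexE (le_trans (ler_normD _ _))// normrM.
rewrite !norm_realc normc_def/= expr0n/= add0r expr1n sqrtr1 mul1r.
by rewrite rmorphD.
Qed.

(** Only [e <= 1] is tested, so that errors of the form [(C + e) * e] can be absorbed into
    [M * e]. *)
Lemma ler_epsilon (x y M : R[i]) : 0 <= M ->
  (forall e, 0 < e -> e <= 1 -> x <= y + M * e) -> x <= y.
Proof.
move=> M0 h; apply/ler_addgt0Pr => e e0.
have M1 : 0 < M + 1 by rewrite ltr_wpDl.
have eM : 0 < e + (M + 1) by rewrite addr_gt0.
(* This value is at most 1, and its product with [M] is at most [e]. *)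
have := h (e / (e + (M + 1))); rewrite divr_gt0// => /(_ isT).
rewrite ler_pdivrMr// mul1r lerDl ltW// => /(_ isT) /le_trans; apply.
rewrite lerD2l mulrCA ger_pMr// ler_pdivrMr// mul1r addrCA lerDl.
by rewrite addr_ge0 ?ltW.
Qed.

Lemma ler_epsilon_eq0 (y M : R[i]) : 0 <= M ->
  (forall e, 0 < e -> e <= 1 -> `|y| <= M * e) -> y = 0.
Proof.
move=> M0 h; apply/normr0_eq0/le_anti; rewrite normr_ge0 andbT.
by apply: (ler_epsilon M0) => e e0 e1; rewrite add0r h.
Qed.

(** Real and imaginary parts converge because [R] is complete. The conclusion keeps the modulus of
    every small set of the filter, since the later estimates need the rate and not only the
    limit. *)
Lemma complex_cauchy (T : Type) (F : set_system T) (f : T -> R[i]) :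
  ProperFilter F ->
  (forall e, 0 < e -> exists2 A, F A &
     forall a b, A a -> A b -> `|f a - f b| <= e) ->
  exists l, forall e A, F A -> (forall a b, A a -> A b -> `|f a - f b| <= e) ->
    forall a, A a -> `|f a - l| <= e.
Proof.
move=> PF fF.
have part_cvg (p : R[i] -> R) : (forall x y, p (x - y) = p x - p y) ->
    (forall z, `|p z|%:C%C <= `|z|) -> exists l : R, p (f t) @[t --> F] --> l.
  move=> pB pz; apply/cvg_ex; apply: cauchy_cvg.
  apply/cauchyP => eps eps0.
  have [|A FA Ae] := fF (eps / 2)%:C%C; first by rewrite ltcR divr_gt0.
  have [a Aa] := filter_ex FA; exists (p (f a)).
  suff : F (fun t => ball (p (f a)) eps (p (f t))) by [].
  apply: filterS FA => b Ab; rewrite -ball_normE /ball_/=.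
  rewrite -pB -ltcR (le_lt_trans (pz _))// (le_lt_trans (Ae _ _ Aa Ab))//.
  by rewrite ltcR ltr_pdivrMr// ltr_pMr// ltr1n.
have [l1 cl1] := part_cvg (@complex.Re R) (fun x y => raddfB (@complex.Re R) x y) (@normc_ge_Re _).
have Im_le z : `|complex.Im z|%:C%C <= `|z|.
  rewrite normc_def lecR -sqrtr_sqr ler_wsqrtr// lerDr; exact: sqr_ge0.
have [l2 cl2] := part_cvg (@complex.Im R) (fun x y => raddfB (@complex.Im R) x y) Im_le.
exists (l1 +i* l2)%C => e A FA Ae a Aa; apply/ler_addgt0Pr => _ /posc_real[d d0 ->].
have d20 : 0 < d / 2 by rewrite divr_gt0.
move/cvgrPdist_le : cl1 => /(_ _ d20) F1.
move/cvgrPdist_le : cl2 => /(_ _ d20) F2.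
have [b [Ab b1 b2]] : exists b, [/\ A b, `|l1 - complex.Re (f b)| <= d / 2 &
    `|l2 - complex.Im (f b)| <= d / 2].
  by have [b [[Ab b1] b2]] := filter_ex (filterI (filterI FA F1) F2); exists b.
rewrite -[f a](subrK (f b)) -addrA (le_trans (ler_normD _ _))// lerD ?Ae//.
rewrite (le_trans (ler_norm_ReIm _))// lecR [leRHS]splitr lerD//.
  by rewrite raddfB distrC.
by rewrite raddfB distrC.
Qed.

End ComplexLimits.

(** Semidefinite forms suffice, so that one theory covers the GNS form on [A^n], its completion, and
    the inner product of a given Hilbert space. *)
Record semidot (R : realType) (V : lmodType R[i]) := SemiDot {
  sform :> V -> V -> R[i];
  sformP : forall w, scalar (sform^~ w);
  sformC : forall v w, sform w v = (sform v w)^*;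
  sform_ge0 : forall v, 0 <= sform v v
}.

Section SemiDotTheory.
Variables (R : realType) (V : lmodType R[i]) (B : semidot V).
Implicit Types (u v w : V) (a e : R[i]).

Lemma sformDl u v w : B (u + v) w = B u w + B v w.
Proof. by have := sformP B w 1 u v; rewrite scale1r mul1r. Qed.

Lemma sform0l w : B 0 w = 0.
Proof. by apply: (addrI (B 0 w)); rewrite -sformDl !addr0. Qed.

Lemma sformZl a v w : B (a *: v) w = a * B v w.
Proof. by have := sformP B w a v 0; rewrite !addr0 sform0l addr0. Qed.

Lemma sformNl v w : B (- v) w = - B v w.
Proof. by rewrite -scaleN1r sformZl mulN1r. Qed.

Lemma sformBl u v w : B (u - v) w = B u w - B v w.
Proof. by rewrite sformDl sformNl. Qed.

Lemma sformDr u v w : B w (u + v) = B w u + B w v.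
Proof. by rewrite sformC sformDl rmorphD/= -!sformC. Qed.

Lemma sformZr a v w : B w (a *: v) = a^* * B w v.
Proof. by rewrite sformC sformZl rmorphM/= -sformC. Qed.

Lemma sformNr v w : B w (- v) = - B w v.
Proof. by rewrite sformC sformNl rmorphN/= -sformC. Qed.

Lemma sformBr u v w : B w (u - v) = B w u - B w v.
Proof. by rewrite sformDr sformNr. Qed.

Lemma sform0r w : B w 0 = 0.
Proof. by rewrite sformC sform0l rmorph0. Qed.

Lemma sform_suml (I : finType) (f : I -> V) w :
  B (\sum_i f i) w = \sum_i B (f i) w.
Proof. by elim/big_rec2: _ => [|i y x _ <-]; rewrite ?sform0l ?sformDl. Qed.

Lemma sform_sumr (I : finType) (f : I -> V) w :
  B w (\sum_i f i) = \sum_i B w (f i).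
Proof. by elim/big_rec2: _ => [|i y x _ <-]; rewrite ?sform0r ?sformDr. Qed.

Lemma sform_parallelogram u v :
  B (u - v) (u - v) = 2 * B u u + 2 * B v v - B (u + v) (u + v).
Proof. by rewrite sformBl !sformBr sformDl !sformDr; ring. Qed.

Definition snorm v := sqrtC (B v v).

Lemma snorm_ge0 v : 0 <= snorm v.
Proof. by rewrite sqrtC_ge0 sform_ge0. Qed.

Lemma sqr_snorm v : snorm v ^+ 2 = B v v.
Proof. exact: sqrtCK. Qed.

Lemma snormZ a v : snorm (a *: v) = `|a| * snorm v.
Proof.
apply/eqP; rewrite -(@eqrXn2 _ 2)// ?mulr_ge0 ?snorm_ge0//.
by rewrite exprMn !sqr_snorm sformZl sformZr mulrA normCK.
Qed.

(** As [B w w] may vanish, it is replaced by [D = B w w + e]; nonnegativity of the form at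
    [D *: v - b *: w] gives the inequality up to [e]. *)
Lemma sform_CauchySchwarz v w : `|B v w| <= snorm v * snorm w.
Proof.
rewrite -(@ler_pXn2r _ 2)// ?nnegrE ?mulr_ge0 ?snorm_ge0// exprMn !sqr_snorm.
have v0 := sform_ge0 B v.
apply: (ler_epsilon v0) => e e0 _; rewrite -mulrDr.
set b := B v w; set D := B w w + e.
have D0 : 0 < D by rewrite ltr_wpDl ?sform_ge0.
have := sform_ge0 B (D *: v - b *: w).
rewrite sformBl !sformBr !sformZl !sformZr -/b [B w v]sformC -/b.
have -> : D^* = D by apply: conj_Creal; exact: gtr0_real.
have bb : b * b^* = `|b| ^+ 2 by rewrite normCK.
rewrite (_ : _ - _ = D * (D * B v v - `|b| ^+ 2) - e * `|b| ^+ 2); last first.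
  by rewrite -bb /D; ring.
rewrite subr_ge0 => /(le_trans (mulr_ge0 (ltW e0) (exprn_ge0 2 (normr_ge0 b)))).
by rewrite pmulr_rge0// subr_ge0 mulrC.
Qed.

Lemma snormD v w : snorm (v + w) <= snorm v + snorm w.
Proof.
rewrite -(@ler_pXn2r _ 2)// ?nnegrE ?addr_ge0 ?snorm_ge0//.
rewrite sqrrD !sqr_snorm sformDl !sformDr [B w v]sformC.
rewrite addrA lerD2r -addrA lerD2l.
rewrite (le_trans (real_ler_norm _))//.
  by rewrite CrealE rmorphD/= conjCK addrC.
rewrite (le_trans (ler_normD _ _))// norm_conjC -mulr2n lerMn2r.
exact: sform_CauchySchwarz.
Qed.

Lemma snorm_le v a : 0 <= a -> B v v <= a ^+ 2 -> snorm v <= a.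
Proof.
by move=> a0; rewrite -sqr_snorm ler_pXn2r// nnegrE// snorm_ge0.
Qed.

End SemiDotTheory.

Section Completion.
Variables (R : realType) (V : lmodType R[i]) (B : semidot V).
Implicit Types (h k : V -> R[i]) (u v w : V) (a e : R[i]).
Local Notation N := (snorm B).

(* An element [f] of the completion is represented by the antilinear functional
   [w |-> <f, w>], a limit of functionals [B v] in the dual norm: no quotient is
   needed. *)
Definition approx h v e := forall w, `|h w - B v w| <= e * N w.

Definition approximable : {pred V -> R[i]} :=
  fun h => `[< forall e, 0 < e -> exists v, approx h v e >].

Lemma approximableP h :
  reflect (forall e, 0 < e -> exists v, approx h v e) (h \in approximable).
Proof. exact: asboolP. Qed.

Lemma approximable_submod : submod_closed approximable.
Proof.
split=> [|a h k /approximableP hA /approximableP kA]; apply/approximableP.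
  move=> e e0; exists 0 => w.
  by rewrite sform0l subr0 normr0 mulr_ge0 ?snorm_ge0// ltW.
move=> e e0; pose d := e / (`|a| + 1).
have a1 : 0 < `|a| + 1 by rewrite ltr_wpDl.
have d0 : 0 < d by rewrite divr_gt0.
have [[v hv] [v' kv]] := (hA d d0, kA d d0); exists (a *: v + v') => w.
rewrite sformDl sformZl [(a *: h + k) w]/(a * h w + k w) opprD addrACA -mulrBr.
rewrite (le_trans (ler_normD _ _))// normrM.
have -> : e = `|a| * d + d.
  by rewrite -{2}[d]mul1r -mulrDl mulrC divfK// gt_eqF.
by rewrite mulrDl -mulrA lerD// ler_wpM2l.
Qed.

HB.instance Definition _ :=
  GRing.isSubmodClosed.Build R[i] (V -> R[i]) approximable approximable_submod.

Record completion := Completion {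
  cfun :> V -> R[i];
  cfunP : cfun \in approximable }.

HB.instance Definition _ := [isSub for cfun].
HB.instance Definition _ := [Choice of completion by <:].
HB.instance Definition _ := [SubChoice_isSubLmodule of completion by <:].


Implicit Types (f g : completion).

Lemma cfun_scaleD a f g w : (a *: f + g) w = a * f w + g w.
Proof. by []. Qed.

Lemma cfun_exists f e : 0 < e -> exists v, approx f v e.
Proof. by move: e; apply/approximableP/cfunP. Qed.

Lemma cfun_antilinear f a u v : f (a *: u + v) = a^* * f u + f v.
Proof.
apply/eqP; rewrite -subr_eq0; apply/eqP.
apply: (@ler_epsilon_eq0 _ _ (N (a *: u + v) + (`|a| * N u + N v))).
  by rewrite !addr_ge0 ?mulr_ge0 ?snorm_ge0.
move=> e e0 _; have [x fx] := cfun_exists f e0.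
pose r w := f w - B x w; have rle w : `|r w| <= e * N w by exact: fx.
rewrite (_ : _ - _ = r (a *: u + v) - (a^* * r u + r v)); last first.
  by rewrite /r sformDr sformZr; ring.
rewrite (le_trans (ler_normB _ _))// [leRHS]mulrC [leRHS]mulrDr lerD//.
rewrite (le_trans (ler_normD _ _))// [leRHS]mulrDr lerD// normrM norm_conjC mulrCA.
by rewrite ler_wpM2l.
Qed.

Lemma cfun_bounded f : exists2 M, 0 <= M & forall w, `|f w| <= M * N w.
Proof.
have [v fv] := cfun_exists f ltr01; exists (1 + N v).
  by rewrite addr_ge0 ?snorm_ge0.
move=> w; rewrite -[f w](subrK (B v w)) (le_trans (ler_normD _ _))// mulrDl lerD//.
exact: sform_CauchySchwarz.
Qed.

Lemma cfunB f u v : f (u - v) = f u - f v.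
Proof.
by rewrite addrC -scaleN1r cfun_antilinear rmorphN rmorph1 mulN1r addrC.
Qed.

Lemma approx_close h u v d e : approx h u d -> approx h v e -> 0 < d -> 0 < e ->
  N (u - v) <= d + e.
Proof.
move=> hu hv d0 e0.
have [->|N0] := eqVneq (N (u - v)) 0; first by rewrite addr_ge0// ltW.
have {}N0 : 0 < N (u - v) by rewrite lt_def N0 snorm_ge0.
rewrite -(ler_pM2r N0) -expr2 sqr_snorm -[leLHS]ger0_norm ?sform_ge0//.
set w := u - v; rewrite {1}/w sformBl.
rewrite (_ : _ - _ = (h w - B v w) - (h w - B u w)); last by ring.
by rewrite (le_trans (ler_normB _ _))// addrC mulrDl lerD.
Qed.

(* [<f, g>] is the limit of [f v = <f, v>] as [v] runs through approximations
   of [g]. *)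
Lemma cdot_exists f g : exists z, forall M, 0 <= M -> (forall w, `|f w| <= M * N w) ->
  forall e v, 0 < e -> approx g v e -> `|f v - z| <= M * (e + e).
Proof.
pose F := filter_from [set e : R[i] | 0 < e] (fun e => [set v | approx g v e]).
have PF : ProperFilter F.
  apply: filter_from_proper; last by move=> e /= /(cfun_exists g).
  apply: filter_from_filter; first by exists 1 => /=; exact: ltr01.
  move=> d e /= d0 e0; have de0 : 0 < d + e by rewrite addr_gt0.
  (* The order of [R[i]] is partial; [x * y / (x + y)] stands in for the minimum of [x] and [y]. *)
  have le_de (x y : R[i]) : 0 < x -> 0 < y -> x * y / (x + y) <= x.
    move=> x0 y0; rewrite -mulrA ger_pMr// ler_pdivrMr ?addr_gt0//.
    by rewrite mul1r lerDr ltW.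
  exists (d * e / (d + e)) => /=; first by rewrite divr_gt0 ?mulr_gt0.
  move=> v /= gv; split=> w; rewrite (le_trans (gv w))// ler_wpM2r ?snorm_ge0//.
    exact: le_de.
  by rewrite [d * e]mulrC [d + e]addrC; exact: le_de.
have Mb M : 0 <= M -> (forall w, `|f w| <= M * N w) -> forall e u v, 0 < e ->
    approx g u e -> approx g v e -> `|f u - f v| <= M * (e + e).
  move=> M0 fM e u v e0 gu gv; rewrite -cfunB (le_trans (fM _))// ler_wpM2l//.
  exact: (approx_close gu gv e0 e0).
have [|z fz] := @complex_cauchy R V F f PF.
  move=> e e0; have [M M0 fM] := cfun_bounded f.
  have M1 : 0 < M + 1 by rewrite ltr_wpDl.
  pose d := e / (2 * (M + 1)).
  have d0 : 0 < d by rewrite divr_gt0 ?mulr_gt0.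
  exists [set v | approx g v d]; first by exists d.
  move=> u v gu gv; rewrite (le_trans (Mb M M0 fM d u v d0 gu gv))//.
  have -> : d + d = e / (M + 1) by rewrite /d; field; exact: lt0r_neq0.
  by rewrite mulrCA ger_pMr// ler_pdivrMr// mul1r lerDl.
exists z => M M0 fM e v e0 gv.
apply: (fz _ [set v | approx g v e]) => //; first by exists e.
by move=> a b ga gb; exact: Mb.
Qed.

Definition cdot f g := sval (cid (cdot_exists f g)).

Lemma cdotP f g M e v : 0 <= M -> (forall w, `|f w| <= M * N w) -> 0 < e ->
  approx g v e -> `|f v - cdot f g| <= M * (e + e).
Proof. by rewrite /cdot; case: cid => z /= h M0 fM; exact: h. Qed.

Lemma cdot_unique f g z c : 0 <= c ->
  (forall e, 0 < e -> e <= 1 -> exists2 v, approx g v e & `|f v - z| <= c * e) ->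
  cdot f g = z.
Proof.
move=> c0 h; have [M M0 fM] := cfun_bounded f.
apply/eqP; rewrite -subr_eq0; apply/eqP.
apply: (@ler_epsilon_eq0 _ _ (c + (M + M))); first by rewrite !addr_ge0.
move=> e e0 e1; have [v gv fv] := h e e0 e1.
rewrite (_ : _ - _ = (f v - z) - (f v - cdot f g)); last by ring.
rewrite (le_trans (ler_normB _ _))// mulrDl lerD//.
by rewrite mulrDl -mulrDr; exact: cdotP.
Qed.

Lemma cdot_scalar g : scalar (cdot^~ g).
Proof.
move=> a f h /=; have [M M0 fM] := cfun_bounded f; have [L L0 hL] := cfun_bounded h.
apply: (@cdot_unique _ _ _ (`|a| * (M + M) + (L + L))).
  by rewrite addr_ge0 ?mulr_ge0 ?addr_ge0.
move=> e e0 e1; have [v gv] := cfun_exists g e0; exists v => //.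
rewrite cfun_scaleD opprD addrACA -mulrBr (le_trans (ler_normD _ _))//.
rewrite mulrDl lerD//.
  rewrite normrM -mulrA ler_wpM2l// mulrDl -mulrDr; exact: cdotP.
by rewrite mulrDl -mulrDr; exact: cdotP.
Qed.

Lemma approx_bound f M e v : 0 < e -> (forall w, `|f w| <= M * N w) -> 0 <= M ->
  approx f v e -> N v <= M + e.
Proof.
move=> e0 fM M0 fv.
have [->|N0] := eqVneq (N v) 0; first by rewrite addr_ge0// ltW.
have {}N0 : 0 < N v by rewrite lt_def N0 snorm_ge0.
rewrite -(ler_pM2r N0) -expr2 sqr_snorm -[leLHS]ger0_norm ?sform_ge0//.
rewrite -[B v v](subrK (f v)) (le_trans (ler_normD _ _))//.
by rewrite addrC mulrDl lerD// distrC.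
Qed.

Lemma cdotC f g : cdot g f = (cdot f g)^*.
Proof.
have [M M0 fM] := cfun_bounded f; have [L L0 gL] := cfun_bounded g.
apply: (@cdot_unique _ _ _ ((M + 1) + (L + 1) + (M + M))).
  by rewrite !addr_ge0.
move=> e e0 e1; have [v fv] := cfun_exists f e0; exists v => //.
have [w gw] := cfun_exists g e0.
rewrite (_ : _ - _ = (g v - B w v) - (f w - B v w)^* + (f w - cdot f g)^*); last first.
  by rewrite !rmorphB/= [B w v]sformC; ring.
rewrite (le_trans (ler_normD _ _))// mulrDl lerD//; last first.
  by rewrite norm_conjC mulrDl -mulrDr; exact: cdotP.
rewrite (le_trans (ler_normB _ _))// mulrDl norm_conjC lerD//.
  rewrite (le_trans (gw v))// mulrC ler_wpM2r ?(ltW e0)//.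
  by rewrite (le_trans (approx_bound e0 fM M0 fv))// lerD2l.
rewrite (le_trans (fv w))// mulrC ler_wpM2r ?(ltW e0)//.
by rewrite (le_trans (approx_bound e0 gL L0 gw))// lerD2l.
Qed.

Lemma cdot_ge0 f : 0 <= cdot f f.
Proof.
have [M M0 fM] := cfun_bounded f.
apply: (@ler_epsilon _ _ _ (M + 1 + (M + M))); first by rewrite !addr_ge0.
move=> e e0 e1; have [v fv] := cfun_exists f e0.
rewrite -lerBlDl sub0r -subr_ge0 opprK addrC -lerBlDr sub0r.
have Br : B v v \is Num.real by rewrite ger0_real ?sform_ge0.
have dr : cdot f f \is Num.real by rewrite CrealE -cdotC.
rewrite -subr_ge0 opprK -(subrK (B v v) (cdot f f)) addrAC addr_ge0 ?sform_ge0//.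
rewrite addrC -lerBlDr sub0r opprB (le_trans (real_ler_norm _)) ?rpredB//.
rewrite (_ : _ - _ = (f v - cdot f f) - (f v - B v v)); last by ring.
rewrite (le_trans (ler_normB _ _))// addrC mulrDl lerD//.
  rewrite (le_trans (fv v))// mulrC ler_wpM2r ?(ltW e0)//.
  by rewrite (le_trans (approx_bound e0 fM M0 fv))// lerD2l.
by rewrite mulrDl -mulrDr; exact: cdotP.
Qed.

Definition cdot_semidot : semidot completion :=
  SemiDot cdot_scalar cdotC cdot_ge0.

Lemma cdot_le f a : 0 <= a -> (forall w, `|f w| <= a * N w) -> cdot f f <= a ^+ 2.
Proof.
move=> a0 fa; apply: (@ler_epsilon _ _ _ (a + (a + a))); first by rewrite !addr_ge0.
move=> e e0 _; have [v fv] := cfun_exists f e0.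
rewrite -[leLHS]ger0_norm ?cdot_ge0// -[cdot f f](subKr (f v)).
rewrite (le_trans (ler_normB _ _))// mulrDl addrA lerD//; last first.
  by rewrite mulrDl -mulrDr; exact: cdotP.
rewrite (le_trans (fa v))// expr2 -mulrDr ler_wpM2l//.
exact: (approx_bound e0 fa a0 fv).
Qed.

Lemma embed_approx v e : 0 < e -> approx (B v) v e.
Proof. by move=> e0 w; rewrite subrr normr0 mulr_ge0 ?snorm_ge0// ltW. Qed.

Lemma embedP v : (B v : V -> R[i]) \in approximable.
Proof. by apply/approximableP => e e0; exists v; exact: embed_approx. Qed.

Definition embed v := Completion (embedP v).

Lemma embed_linear : linear embed.
Proof.
move=> a u v; apply/val_inj/funext => w /=.
by rewrite sformDl sformZl.
Qed.

Lemma cdot_embed f v : cdot f (embed v) = f v.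
Proof.
have [M M0 fM] := cfun_bounded f.
apply: (@cdot_unique _ _ _ 0) => // e e0 _; exists v; first exact: embed_approx.
by rewrite subrr normr0 mul0r.
Qed.

(** Definiteness comes without a quotient: [f w] is the product of [f] with [embed w], so
    Cauchy-Schwarz bounds it by the norm of [f]. *)
Lemma cdot_eq0 f : cdot f f = 0 -> f = 0.
Proof.
move=> f0; apply/val_inj/funext => w /=; rewrite -cdot_embed.
apply/normr0_eq0/le_anti; rewrite normr_ge0 andbT.
rewrite (le_trans (sform_CauchySchwarz cdot_semidot _ _))//.
by rewrite {1}/snorm/= f0 sqrtC0 mul0r.
Qed.

Let norm_eq0 f : snorm cdot_semidot f = 0 -> f = 0.
Proof.
by move=> f0; apply: cdot_eq0; have := sqr_snorm cdot_semidot f; rewrite f0 expr0n.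
Qed.

HB.instance Definition _ := Lmodule_isNormed.Build R[i] completion
  (snormD cdot_semidot) (snormZ cdot_semidot) norm_eq0.

Lemma cfun_le_norm f w : `|f w| <= `|f| * N w.
Proof.
rewrite -cdot_embed (le_trans (sform_CauchySchwarz cdot_semidot _ _))//.
by rewrite ler_wpM2l ?snorm_ge0// /snorm/= cdot_embed.
Qed.

Lemma norm_le_cfun f a : 0 <= a -> (forall w, `|f w| <= a * N w) -> `|f| <= a.
Proof. by move=> a0 fa; apply: snorm_le => //; exact: cdot_le. Qed.

(** Limits are taken pointwise in [R[i]]. The retained modulus makes the convergence uniform
    relative to [N], which carries approximability over to the limit. *)
Lemma completion_complete (F : set_system completion) :
  ProperFilter F -> cauchy F -> cvg F.
Proof.
move=> PF /cauchyP Fc.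
have Fe e : 0 < e -> exists2 A : set completion, F A & forall f g, A f -> A g -> `|f - g| <= e.
  move=> e0; have [f Ff] := Fc (e / 2) (divr_gt0 e0 (ltr0Sn _ 1)).
  exists (ball f (e / 2)) => // g h; rewrite -ball_normE/= => fg fh.
  rewrite -[g](subrK f) -addrA (le_trans (ler_normD _ _))// [e]splitr.
  by rewrite lerD// ?ltW// distrC.
have lim w : exists l, forall e A, F A -> (forall f g : completion, A f -> A g -> `|f - g| <= e) ->
    0 < e -> forall f, A f -> `|f w - l| <= e * N w.
  have sub f g : `|f w - g w| <= `|f - g| * N w by exact: (cfun_le_norm (f - g)).
  have [|l fl] := @complex_cauchy R completion F (fun f => f w) PF.
    move=> e e0; have N1 : 0 < N w + 1 by rewrite ltr_wpDl ?snorm_ge0.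
    have [A FA Ae] := Fe (e / (N w + 1)) (divr_gt0 e0 N1); exists A => // f g Af Ag.
    rewrite (le_trans (sub f g))// (le_trans (ler_wpM2r (snorm_ge0 _ _) (Ae f g Af Ag)))//.
    by rewrite mulrAC ler_pdivrMr// ler_wpM2l ?ltW// ltrDl.
  exists l => e A FA Ae e0 f Af; apply: (fl _ A) => // g h Ag Ah.
  by rewrite (le_trans (sub g h))// ler_wpM2r ?snorm_ge0// Ae.
pose l w := sval (cid (lim w)).
have lP e A : F A -> (forall f g : completion, A f -> A g -> `|f - g| <= e) ->
    0 < e -> forall f, A f -> forall w, `|f w - l w| <= e * N w.
  by move=> FA Ae e0 f Af w; rewrite /l; case: cid => /= z /(_ e A FA Ae e0); apply.
have l_approx : l \in approximable.
  apply/approximableP => e e0; have e20 := divr_gt0 e0 (ltr0Sn _ 1).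
  have [A FA Ae] := Fe _ e20; have [f Af] := filter_ex FA.
  have [v fv] := cfun_exists f e20; exists v => w.
  rewrite (_ : _ - _ = (f w - B v w) - (f w - l w)); last by ring.
  rewrite (le_trans (ler_normB _ _))// [e]splitr mulrDl lerD//.
  exact: (lP _ _ FA Ae e20 _ Af).
apply/cvg_ex; exists (Completion l_approx); apply/cvgrPdist_le => e e0.
have [A FA Ae] := Fe _ e0; apply: (filterS _ FA) => f Af.
rewrite distrC; apply: norm_le_cfun; first exact: ltW.
by move=> w; exact: (lP e A).
Qed.

HB.instance Definition _ := Uniform_isComplete.Build completion completion_complete.

HB.instance Definition _ := @isBilinear.Build R[i] completion completion R[i]
  ( *%R ) (Num.conj \; *%R) cdot
  (fun p f g => sformBl cdot_semidot f g p) (fun p f g => sformBr cdot_semidot f g p)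
  (fun g a f => sformZl cdot_semidot a f g) (fun f a g => sformZr cdot_semidot a g f).

HB.instance Definition _ := @isHermitianSesquilinear.Build R[i] completion false Num.conj cdot
  (fun x y => etrans (cdotC y x) (esym (mul1r _))).

Lemma cdot_gt0 f : f != 0 -> 0 < cdot f f.
Proof.
move=> f0; rewrite lt_def cdot_ge0 andbT; apply: contra_neq f0; exact: cdot_eq0.
Qed.

HB.instance Definition _ := @isDotProduct.Build R[i] completion cdot cdot_gt0.

Let cdot_norm f : `|f| ^+ 2 = (cdot : {dot completion for Num.conj}) f f.
Proof. exact: (sqr_snorm cdot_semidot). Qed.

HB.instance Definition _ := isHilbert.Build R completion cdot_norm.

End Completion.

(** * Hilbert spaces *)

Section HilbertTheory.
Variables (R : realType) (H : hilbertType R).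
Implicit Types (x y z : H) (W : set H) (a : R[i]).

Let hdot_scalar w : scalar ((hdot : H -> H -> R[i])^~ w).
Proof. by move=> a x y /=; rewrite linearPl. Qed.

Let hdotC x y : '[y, x] = '[x, y]^*.
Proof. by rewrite hermC mul1r. Qed.

Let hdot_ge0 x : 0 <= '[x, x].
Proof. exact: dnorm_ge0. Qed.

Definition hilbert_semidot : semidot H := SemiDot hdot_scalar hdotC hdot_ge0.
Local Notation D := hilbert_semidot.

Lemma hdotE x y : '[x, y] = D x y. Proof. by []. Qed.

Lemma hilbert_normE x : `|x| = snorm D x.
Proof. by rewrite /snorm/= -hnormE sqrCK. Qed.

Lemma hdot_eq0 x : '[x, x] = 0 -> x = 0.
Proof. by rewrite -hnormE => /eqP; rewrite expf_eq0/= normr_eq0 => /eqP. Qed.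

(** Near-minimisers of the distance form a Cauchy filter by the parallelogram law ([par]) and are
    already nearly orthogonal to [W] ([key]), so orthogonality is obtained by passing to the
    limit. *)
Lemma orthogonal_projection W x : Defs.subspace W -> closed W ->
  exists2 y, W y & forall w, W w -> '[x - y, w] = 0.
Proof.
move=> [W0 WP] Wcl.
have WD u v : W u -> W v -> W (u + v).
  by move=> Wu Wv; rewrite -[u]scale1r; exact: WP.
have WZ a u : W u -> W (a *: u).
  by move=> Wu; rewrite -[_ *: u]addr0; exact: WP.
pose r w := complex.Re '[x - w, x - w].
have rE w : '[x - w, x - w] = (r w)%:C%C by rewrite RRe_real// ger0_real// hdot_ge0.
have r0 w : 0 <= r w by rewrite -(lecR 0 (r w)) -rE hdot_ge0.
pose E := [set r w | w in W]; pose d := inf E.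
have lE : has_lbound E by exists 0 => _ [w _ <-].
have dr w : W w -> d <= r w by move=> Ww; apply: ge_inf => //; exists w.
pose G (e : R) := [set w | W w /\ r w <= d + e].
have key e w v : G e w -> W v -> `|'[x - w, v]| ^+ 2 <= e%:C%C * ('[v, v] + 1).
  move=> [Ww rw] Wv; have [u uE] : {u | u = x - w} by exists (x - w).
  rewrite -uE; pose b := '[u, v]; rewrite -/b; pose n := '[v, v].
  have n0 : 0 <= n by exact: hdot_ge0.
  have n1 : 0 < n + 1 by rewrite ltr_wpDl.
  (* The best coefficient would be [b / n]. Dividing by [n + 1] also covers [v = 0] and still lowers
     the squared distance by at least [s * |b|^2]. *)
  pose s := (n + 1)^-1; have s0 : 0 < s by rewrite invr_gt0.
  have sr : s^* = s by apply: conj_Creal; exact: gtr0_real.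
  have Ww' : W (w + (s * b) *: v) by apply: WD => //; exact: WZ.
  have := dr _ Ww'; rewrite -lecR -rE opprD addrA -uE.
  have := rE w; rewrite -uE => rEw.
  rewrite hdotE sformBl !sformBr !sformZl !sformZr -!hdotE rEw [ '[v, u] ]hdotC.
  rewrite -/n -/b.
  rewrite rmorphM/= sr.
  rewrite (_ : _ - _ = (r w)%:C%C - (s * `|b| ^+ 2) * (1 + (1 - s * n))); last first.
    by rewrite normCK; ring.
  have sn : 0 <= 1 - s * n.
    by rewrite subr_ge0 /s ler_pdivrMl// mulr1 lerDl.
  rewrite lerBrDr => h; rewrite -ler_pdivrMr// mulrC -(lerD2l d%:C%C).
  have sb : 0 <= s * `|b| ^+ 2 by rewrite mulr_ge0 ?(ltW s0)// exprn_ge0.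
  apply: (le_trans (_ : _ <= d%:C%C + s * `|b| ^+ 2 * (1 + (1 - s * n)))).
    by rewrite lerD2l ler_peMr// lerDl.
  by rewrite (le_trans h)// -rmorphD/= lecR.
have par e u v : G e u -> G e v -> '[u - v, u - v] <= (4 * e)%:C%C.
  move=> [Wu ru] [Wv rv]; pose m := 2^-1 *: (u + v).
  have /dr : W m by apply: WZ; exact: WD.
  have -> : u - v = (x - v) - (x - u) by rewrite opprB [RHS]addrC addrA subrK.
  have : (x - v) + (x - u) = 2 *: (x - m).
    rewrite /m scalerBr scalerA mulfV ?pnatr_eq0// scale1r scaler_nat mulr2n.
    by rewrite addrACA -opprD [v + u]addrC.
  rewrite hdotE sform_parallelogram => ->.
  rewrite sformZl sformZr -!hdotE !rE conjC_nat => dm.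
  rewrite (_ : _ - _ = (2 * r v + 2 * r u - 4 * r m)%:C%C).
    by rewrite lecR; lra.
  by rewrite rmorphB rmorphD !rmorphM/= !rmorph_nat; ring.
have G0 e : 0 < e -> exists w, G e w.
  move=> e0; have hE : has_inf E by split=> //; exists (r 0), 0.
  have [_ [w Ww <-] rw] := inf_adherent e0 hE.
  by exists w; split=> //; exact: ltW.
pose F := filter_from [set e : R | 0 < e] G.
have PF : ProperFilter F.
  apply: filter_from_proper => //; apply: filter_from_filter; first by exists 1 => /=.
  move=> e1 e2 /= e10 e20; exists (Num.min e1 e2) => /=; first by rewrite lt_min e10.
  by move=> w [Ww h]; split; split=> //; rewrite (le_trans h)// lerD2l ge_min lexx ?orbT.
have : cvg F.
  apply: cauchy_cvg; apply/cauchyP => _ /posc_real[e e0 ->].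
  (* [par] turns this tolerance into the bound [e ^+ 2 / 2], strictly below [e ^+ 2]. *)
  have e20 : 0 < e ^+ 2 / 8 by rewrite divr_gt0 ?exprn_gt0.
  have [w Gw] := G0 _ e20; exists w; exists (e ^+ 2 / 8) => //= v Gv.
  rewrite -ball_normE/= -(@ltr_pXn2r _ 2)// ?nnegrE ?normr_ge0 ?lecR ?(ltW e0)//.
  rewrite hnormE (le_lt_trans (par _ _ _ Gw Gv))// -rmorphXn/= ltcR.
  have := exprn_gt0 2 e0; lra.
move=> /cvg_ex[y Fy]; exists y.
  apply: (@closed_cvg _ _ F _ id W Wcl _ _ Fy).
  by exists 1 => //= w [].
move=> v Wv; pose c := sqrtC ('[v, v] + 1).
have v1 : 0 <= '[v, v] + 1 by rewrite addr_ge0 ?hdot_ge0.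
apply: (@ler_epsilon_eq0 _ _ (c + `|v|)); first by rewrite addr_ge0// sqrtC_ge0.
move=> _ /posc_real[e e0 ->] _.
have e20 : 0 < e ^+ 2 by rewrite exprn_gt0.
have F1 : F (G (e ^+ 2)) by exists (e ^+ 2).
have e0' : 0 < e%:C%C :> R[i] by rewrite ltcR.
have /cvgrPdist_le /(_ _ e0') F2 : id w @[w --> F] --> y := Fy.
have [w [Gw yw]] := filter_ex (filterI F1 F2).
rewrite -(subrK w x) -addrA hdotE sformDl -!hdotE.
rewrite (le_trans (ler_normD _ _))// mulrDl lerD//.
  rewrite -(@ler_pXn2r _ 2)// ?nnegrE ?normr_ge0 ?mulr_ge0 ?sqrtC_ge0 ?(ltW e0')//.
  by rewrite exprMn sqrtCK [leRHS]mulrC -[e%:C%C ^+ 2]rmorphXn/=; exact: key.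
rewrite (le_trans (sform_CauchySchwarz D _ _))// -!hilbert_normE mulrC.
by rewrite ler_wpM2l// distrC.
Qed.

Lemma exists_bounded_op (K : hilbertType R) (T : H -> K) (M : R[i]) :
  0 <= M -> linear T -> (forall x, `|T x| <= M * `|x|) ->
  exists S : boundedOpType H K, forall x, S x = T x.
Proof.
move=> M0 Tl TM.
have cT : continuous T.
  move=> x; apply/cvgrPdist_le => e e0.
  have M1 : 0 < M + 1 by rewrite ltr_wpDl.
  have : \forall y \near x, `|x - y| <= e / (M + 1).
    have /cvgrPdist_le := @cvg_id _ (nbhs x); apply; exact: divr_gt0.
  apply: filterS => y xy.
  have -> : T x - T y = T (x - y) by rewrite addrC -scaleN1r -Tl scaleN1r addrC.
  rewrite (le_trans (TM _))// (le_trans (ler_wpM2l M0 xy))// mulrCA.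
  by rewrite ger_pMr// ler_pdivrMr// mul1r lerDl.
pose S : boundedOpType H K :=
  HB.pack T (GRing.isLinear.Build _ _ _ _ T Tl) (isContinuous.Build _ _ T cT).
by exists S.
Qed.

Lemma orth_proj_eq W (P : 'B(H)) x y : Defs.subspace W -> orth_proj W P ->
  W y -> (forall w, W w -> '[x - y, w] = 0) -> P x = y.
Proof.
move=> [W0 WP] PW Wy yP; have [WPx PxP] := PW x.
apply/eqP; rewrite -subr_eq0; apply/eqP/hdot_eq0.
have Wd : W (P x - y) by rewrite addrC -scaleN1r; exact: WP.
have E : P x - y = (x - y) - (x - P x) by rewrite opprB [RHS]addrC addrA subrK.
by rewrite [X in '[X, _]]E hdotE sformBl -!hdotE PxP// yP// subr0.
Qed.

(** The nearest points are a hypothesis because they have two sources: [orthogonal_projection] for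
    closed subspaces, and [finite_projection] for the range of [V], where closedness does not come
    up. *)
Lemma orth_proj_exists W : Defs.subspace W ->
  (forall x, exists2 y, W y & forall w, W w -> '[x - y, w] = 0) ->
  exists P : 'B(H), orth_proj W P.
Proof.
move=> [W0 WP] Wproj.
have WB u v : W u -> W v -> W (u - v).
  by move=> Wu Wv; rewrite addrC -scaleN1r; exact: WP.
pose T x := s2val (cid2 (Wproj x)).
have WT x : W (T x) by rewrite /T; case: cid2.
have TP x w : W w -> '[x - T x, w] = 0 by rewrite /T; case: cid2 => /= ? _; apply.
have Tuniq x y : W y -> (forall w, W w -> '[x - y, w] = 0) -> T x = y.
  move=> Wy yP; apply/eqP; rewrite -subr_eq0; apply/eqP/hdot_eq0.
  have Wd : W (T x - y) by exact: WB.
  have E : T x - y = (x - y) - (x - T x) by rewrite opprB [RHS]addrC addrA subrK.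
  by rewrite [X in '[X, _]]E hdotE sformBl -!hdotE TP// yP// subr0.
have Tlin : linear T.
  move=> a x y; apply: Tuniq; first exact: WP.
  move=> w Ww; rewrite opprD addrACA -scalerBr hdotE sformDl sformZl -!hdotE.
  by rewrite !TP// mulr0 addr0.
have [x|P PE] := @exists_bounded_op H T 1 ler01 Tlin.
  rewrite mul1r; have [->|T0] := eqVneq `|T x| 0; first exact: normr_ge0.
  have {}T0 : 0 < `|T x| by rewrite lt_def T0 normr_ge0.
  rewrite -(ler_pM2r T0) -expr2 hnormE -[leLHS]ger0_norm ?hdot_ge0//.
  have -> : '[T x, T x] = '[x, T x].
    by apply/esym/eqP; rewrite -subr_eq0 !hdotE -sformBl -hdotE TP.
  by rewrite !hilbert_normE; exact: sform_CauchySchwarz.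
by exists P => x; rewrite PE; split=> // w; exact: TP.
Qed.

(** One Gram-Schmidt step per vector. The [e i] may be dependent: then [f = 0], and orthogonality to
    it is trivial. *)
Lemma finite_projection n (e : 'I_n -> H) x :
  exists c : 'I_n -> R[i], forall i, '[x - \sum_j c j *: e j, e i] = 0.
Proof.
elim: n e x => [|n IHn] e x; first by exists (fun=> 0); case.
pose e' i := e (lift ord0 i).
have [c cP] := IHn e' x; have [b bP] := IHn e' (e ord0).
set y := \sum_j c j *: e' j in cP; set z := \sum_j b j *: e' j in bP.
pose f := e ord0 - z; pose a := '[x - y, f] / '[f, f].
exists (fun i => oapp (fun j => c j - a * b j) a (unlift ord0 i)).
rewrite big_ord_recl unlift_none/=.
have -> : a *: e ord0 + \sum_(i < n) oapp (fun j => c j - a * b j) a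
    (unlift ord0 (lift ord0 i)) *: e (lift ord0 i) = y + a *: f.
  rewrite /f scalerBr addrCA; congr (_ + _).
  rewrite /y /z scaler_sumr -sumrB; apply: eq_bigr => i _.
  by rewrite liftK/= scalerBl scalerA.
have orth_e' i : '[x - (y + a *: f), e' i] = 0.
  by rewrite opprD addrA hdotE sformBl sformZl -!hdotE cP bP mulr0 subr0.
have orth_f : '[x - (y + a *: f), f] = 0.
  rewrite opprD addrA hdotE sformBl sformZl -!hdotE /a.
  have [f0|f0] := eqVneq '[f, f] 0.
    by rewrite f0 (hdot_eq0 f0) !hdotE sform0r mulr0 subr0.
  by rewrite divfK// subrr.
move=> i; case: (unliftP ord0 i) => [j|] ->; first exact: orth_e'.
have -> : e ord0 = f + z by rewrite subrK.
rewrite hdotE sformDr -hdotE orth_f add0r sform_sumr big1// => j _.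
by rewrite sformZr -hdotE orth_e' mulr0.
Qed.

End HilbertTheory.

(** The common kernel of finitely many functionals has finite codimension: the [r j] are preimages
    of rows generating the image of [V] in the row space. *)
Lemma exists_spanning (F : fieldType) (V : lmodType F) (I : finType)
    (J : I -> V -> F) : (forall i, scalar (J i)) ->
  exists M (r : 'I_M -> V), forall v, exists c : 'I_M -> F,
    forall i, J i (v - \sum_j c j *: r j) = 0.
Proof.
move=> Js.
pose JV v : 'rV[F]_#|I| := \row_k J (enum_val k) v.
have JVP a u v : JV (a *: u + v) = a *: JV u + JV v.
  by apply/rowP => k; rewrite !mxE Js.
have [|a _ _ [u _ <-] [v _ <-]|B LB] := @row_subspaceP F #|I| (range JV).
- exists 0 => //; have := JVP (-1) 0 0.
  by rewrite scaler0 addr0 scaleN1r addNr.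
- by exists (a *: u + v).
have /choice[r rP] : forall i, exists v, JV v = row i B.
  by move=> i; have /LB[v _ <-] := row_sub i B; exists v.
exists #|I|, r => v.
have JV0 : JV 0 = 0 by have := JVP (-1) 0 0; rewrite scaler0 addr0 scaleN1r addNr.
have JVs (c : 'I_#|I| -> F) : JV (\sum_j c j *: r j) = \sum_j c j *: row j B.
  elim/big_rec2: _ => // i x y _ IH.
  by rewrite JVP IH rP.
have /submxP[w vw] : (JV v <= B)%MS by apply/LB; exists v.
exists (fun j => w 0 j) => i.
have : JV (v - \sum_j w 0 j *: r j) = 0.
  by rewrite addrC -scaleN1r JVP JVs vw -mulmx_sum_row scaleN1r addNr.
by move=> /rowP/(_ (enum_rank i)); rewrite !mxE enum_rankK.
Qed.

(** An element of the completion is determined by its values at the [r j], so these finitely many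
    evaluations have trivial common kernel on [completion B]. *)
Lemma finite_dim_completion (R : realType) (V : lmodType R[i]) (B : semidot V)
    m (r : 'I_m -> V) :
  (forall v, exists c : 'I_m -> R[i], snorm B (v - \sum_j c j *: r j) = 0) ->
  finite_dim [set: completion B].
Proof.
move=> rP.
have [|M [e eP]] := @exists_spanning R[i] (completion B) 'I_m (fun i f => f (r i)).
  by move=> i a f g.
exists M, e; split=> // f _; have [c cP] := eP f; exists c.
apply/eqP; rewrite -subr_eq0; apply/eqP; move: (_ - _) cP => g gP.
apply/val_inj/funext => v /=; have [b bP] := rP v.
have g0 : g (v - \sum_j b j *: r j) = 0.
  apply/normr0_eq0/le_anti; rewrite normr_ge0 andbT.
  by rewrite (le_trans (cfun_le_norm _ _))// bP mulr0.
have : '[g, embed B (\sum_j b j *: r j)] = 0.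
  have eL := @embed_linear _ _ B.
  have -> : embed B (\sum_j b j *: r j) = \sum_j b j *: embed B (r j).
    elim/big_rec2: _ => [|i x y _ <-]; last exact: eL.
    by have := eL (-1) 0 0; rewrite scaler0 addr0 scaleN1r addNr.
  rewrite hdotE sform_sumr big1// => j _.
  by rewrite sformZr [X in _ * X]cdot_embed gP mulr0.
rewrite [LHS]cdot_embed => gs.
by move: g0; rewrite cfunB gs subr0.
Qed.

(** * C*-algebras and the order unit of the matrices over them *)

Section CStarTheory.
Variables (R : realType) (A : cstarAlgType R).
Implicit Types (a b x y z : A) (c : R[i]).

Lemma cmul0l a : cmul 0 a = 0.
Proof. by apply: (addrI (cmul 0 a)); rewrite -cmulDl !addr0. Qed.

Lemma cmul0r a : cmul a 0 = 0.
Proof. by apply: (addrI (cmul a 0)); rewrite -cmulDr !addr0. Qed.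

Lemma cmulNl a b : cmul (- a) b = - cmul a b.
Proof. by rewrite -scaleN1r cmulZl scaleN1r. Qed.

Lemma cmulNr a b : cmul a (- b) = - cmul a b.
Proof. by rewrite -scaleN1r cmulZr scaleN1r. Qed.

Lemma cmulBl a b z : cmul (a - b) z = cmul a z - cmul b z.
Proof. by rewrite cmulDl cmulNl. Qed.

Lemma cmulBr a b z : cmul z (a - b) = cmul z a - cmul z b.
Proof. by rewrite cmulDr cmulNr. Qed.

Lemma star0 : star (0 : A) = 0.
Proof. by apply: (addrI (star 0)); rewrite -starD !addr0. Qed.

Lemma starN a : star (- a) = - star a.
Proof. by rewrite -scaleN1r starZ rmorphN rmorph1 scaleN1r. Qed.

Lemma starB a b : star (a - b) = star a - star b.
Proof. by rewrite starD starN. Qed.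

Lemma star1 : star (cone A) = cone A.
Proof.
by apply/esym; rewrite -{1}(starK (cone A)) -[X in star X = _]cmul1l starM starK cmul1l.
Qed.

Lemma norm_star a : `|star a| = `|a|.
Proof.
have le x : `|x| <= `|star x|.
  have [->|x0] := eqVneq `|x| 0; first exact: normr_ge0.
  have {}x0 : 0 < `|x| by rewrite lt_def x0 normr_ge0.
  by rewrite -(ler_pM2r x0) -expr2 -cnorm_star cnormM.
by apply/le_anti; rewrite le andbT (le_trans (le _))// starK.
Qed.

Section SquareRoot.
Variable x : A.
Hypotheses (xs : star x = x) (x_le : `|x| <= 2^-1).

(* A fixed point [y] of [phi] satisfies [(1 - y)^2 = 1 - x]; [phi] is a
   contraction of the ball of radius 1/2. *)
Let phi y := 2^-1 *: (x + cmul y y).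
Let U := [set y : A | star y = y /\ `|y| <= 2^-1].

Let half_ge0 : 0 <= 2^-1 :> R[i]. Proof. by rewrite invr_ge0 ler0n. Qed.

Let phi_U y : U y -> U (phi y).
Proof.
move=> [ys y_le]; split.
  by rewrite /phi starZ starD starM ys xs fmorphV/= conjC_nat.
rewrite /phi normrZ ger0_norm// ler_piMr//.
rewrite (le_trans (ler_normD _ _))// (le_trans (lerD x_le (cnormM _ _)))//.
rewrite [leRHS]splitr mul1r lerD2l.
by rewrite (le_trans (ler_pM _ _ y_le y_le))// ler_piMr// invf_le1 ?ler1n ?ltr0n.
Qed.

Let phi_contracts y z : U y -> U z -> `|phi y - phi z| <= 2^-1 * `|y - z|.
Proof.
move=> [_ yU] [_ zU]; rewrite /phi -scalerBr opprD addrACA subrr add0r.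
rewrite normrZ ger0_norm// ler_wpM2l//.
have -> : cmul y y - cmul z z = cmul y (y - z) + cmul (y - z) z.
  by rewrite cmulBl cmulBr addrA subrK.
have E : `|y - z| = 2^-1 * `|y - z| + `|y - z| * 2^-1 by field.
rewrite (le_trans (ler_normD _ _))// [leRHS]E lerD// (le_trans (cnormM _ _))//.
  by rewrite ler_wpM2r.
by rewrite ler_wpM2l.
Qed.

Let iter_dist n : `|iter n.+1 phi 0 - iter n phi 0| <= (2^-1) ^+ n.
Proof.
have U0 : U 0 by split; rewrite ?star0 ?normr0.
have Un m : U (iter m phi 0) by elim: m => [|m IH] //=; exact: phi_U.
elim: n => [|n IHn].
  rewrite expr0 subr0 (le_trans (Un 1).2)// invf_le1 ?ler1n ?ltr0n//.
rewrite exprS [iter n.+2 _ _]iterS [X in _ - X]iterS.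
by rewrite (le_trans (phi_contracts (Un n.+1) (Un n)))// ler_wpM2l.
Qed.

Lemma fixed_point_half : exists2 y : A, star y = y & 2 *: y = x + cmul y y.
Proof.
pose G (e : R[i]) := [set y | U y /\ `|y - phi y| <= e].
pose F := filter_from [set e : R[i] | 0 < e] G.
have G0 e : 0 < e -> exists y, G e y.
  move=> /posc_real[r r0 ->].
  have U0 : U 0 by split; rewrite ?star0 ?normr0.
  have Un m : U (iter m phi 0) by elim: m => [|m IH] //=; exact: phi_U.
  pose n := Num.bound r^-1; exists (iter n phi 0); split=> //.
  rewrite distrC (le_trans (iter_dist n))// exprVn -natrX -[r]invrK.
  rewrite -(rmorph_nat (real_complex R)) -fmorphV lecR lef_pV2 ?posrE ?invr_gt0//; last first.
    by rewrite ltr0n expn_gt0.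
  have := archi_boundP (ltW (_ : 0 < r^-1)); rewrite invr_gt0 => /(_ r0) /ltW/le_trans; apply.
  by rewrite ler_nat ltnW// ltn_expl.
(* Contraction by 1/2 gives [|y - z| <= 2 * e + |y - z| / 2], whence the factor 4 and the tolerance
   [e / 8] below. *)
have Gdist e y z : G e y -> G e z -> `|y - z| <= 4 * e.
  move=> [yU ye] [zU ze].
  have : `|y - z| <= e + 2^-1 * `|y - z| + e.
    rewrite [X in `|X| <= _](_ : _ = (y - phi y) + (phi y - phi z) + (phi z - z)).
      rewrite (le_trans (ler_normD _ _))// lerD//; last by rewrite distrC.
      by rewrite (le_trans (ler_normD _ _))// lerD//; exact: phi_contracts.
    by rewrite !addrA !subrK.
  rewrite addrAC -lerBlDr -[X in X - _]mul1r -mulrBl.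
  rewrite (_ : 1 - 2^-1 = 2^-1 :> R[i]); last by field.
  rewrite ler_pdivrMl// => /le_trans; apply.
  by rewrite (_ : 2 * (e + e) = 4 * e)//; ring.
have PF : ProperFilter F.
  apply: filter_from_proper => //; apply: filter_from_filter; first by exists 1 => /=.
  move=> _ _ /= /posc_real[d d0 ->] /posc_real[e e0 ->].
  exists (Num.min d e)%:C%C => /=; first by rewrite ltcR lt_min d0.
  move=> y [yU ye]; split; split=> //; rewrite (le_trans ye)// lecR.
    by rewrite ge_min lexx.
  by rewrite ge_min lexx orbT.
have : cvg F.
  apply: cauchy_cvg; apply/cauchyP => e e0.
  have e80 : 0 < e / 8 by rewrite divr_gt0// ltr0n.
  have [y Gy] := G0 _ e80; exists y; exists (e / 8) => //= z Gz.
  rewrite -ball_normE/= (le_lt_trans (Gdist _ _ _ Gy Gz))//.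
  rewrite mulrCA gtr_pMr// ltr_pdivrMr ?ltr0n// mul1r ltr_nat//.
move=> /cvg_ex[y Fy].
have near_y e : 0 < e -> exists w, G e w /\ `|y - w| <= e.
  move=> e0; have F1 : F (G e) by exists e.
  have /cvgrPdist_le /(_ _ e0) F2 : id w @[w --> F] --> y := Fy.
  by have [w [Gw yw]] := filter_ex (filterI F1 F2); exists w.
have vanish (v : A) M : 0 <= M -> (forall e, 0 < e -> `|v| <= M * e) -> v = 0.
  move=> M0 h; apply/normr0_eq0/(ler_epsilon_eq0 M0) => e e0 _.
  by rewrite normr_id h.
have ys : star y = y.
  apply/eqP; rewrite -subr_eq0; apply/eqP/(vanish _ 2) => // e e0.
  have [w [[[ws _] _] yw]] := near_y e e0.
  rewrite (_ : _ - _ = star (y - w) - (y - w)); last first.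
    by rewrite starB ws opprB addrA subrK.
  rewrite (le_trans (ler_normB _ _))// norm_star mulrDl mul1r lerD//.
have y_le : `|y| <= 2^-1.
  apply: (@ler_epsilon _ _ _ 1) => // e e0 _; have [w [[[_ w_le] _] yw]] := near_y e e0.
  by rewrite -(subrK w y) mul1r addrC (le_trans (ler_normD _ _))// lerD.
exists y => //.
have yphi : y = phi y.
  apply/eqP; rewrite -subr_eq0; apply/eqP/(vanish _ (1 + 1 + 2^-1)) => [|e e0].
    by rewrite !addr_ge0.
  have [w [[wU ww] yw]] := near_y e e0.
  rewrite (_ : y - _ = (y - w) + (w - phi w) + (phi w - phi y)); last first.
    by rewrite !addrA !subrK.
  rewrite (le_trans (ler_normD _ _))// mulrDl lerD//.
    by rewrite (le_trans (ler_normD _ _))// mulrDl !mul1r lerD.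
  rewrite (le_trans (phi_contracts wU (conj ys y_le)))// ler_wpM2l//.
  by rewrite distrC.
by rewrite [in LHS]yphi /phi scalerA mulfV ?pnatr_eq0// scale1r.
Qed.

End SquareRoot.

Lemma unit_sub_square x : star x = x -> `|x| <= 2^-1 ->
  exists b, cone A - x = cmul (star b) b.
Proof.
move=> xs x_le; have [y ys y2] := fixed_point_half xs x_le; exists (cone A - y).
have -> : x = 2 *: y - cmul y y by rewrite y2 addrK.
rewrite starB star1 ys cmulBl !cmulBr !cmul1l cmul1r !opprB scaler_nat mulr2n opprD.
by rewrite -[RHS]addrA [in RHS](addrCA (- y)).
Qed.

(** The only consequence of the C*-identity that the sequel uses: it bounds hermitian elements by
    multiples of the unit, with hermitian squares as the positive elements. *)
Lemma scaled_unit_sub_square x : star x = x ->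
  exists (s : R) b, 0 <= s /\ s%:C%C *: cone A - x = cmul (star b) b.
Proof.
(* Dividing by this scale brings the norm of [x] to at most 1/2; the summand 1 keeps the scale
   invertible when [x = 0]. *)
move=> xs; have t0 : 0 < 2 * `|x| + 1 by rewrite ltr_wpDl ?mulr_ge0.
have [s s0 sE] := posc_real t0.
have sC0 : 0 < s%:C%C :> R[i] by rewrite ltcR.
have [||b bE] := @unit_sub_square (s%:C%C^-1 *: x).
- by rewrite starZ xs conj_Creal// gtr0_real// invr_gt0.
- rewrite normrZ gtr0_norm ?invr_gt0// ler_pdivrMl// ler_pdivlMr ?ltr0n//.
  by rewrite mulrC -sE lerDl.
pose t := sqrtC s%:C%C; exists s, (t *: b); split; first exact: ltW.
rewrite starZ cmulZl cmulZr -bE scalerA conj_Creal ?ger0_real ?sqrtC_ge0 ?(ltW sC0)//.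
by rewrite -expr2 sqrtCK scalerBr scalerA mulfV ?gt_eqF// scale1r.
Qed.

End CStarTheory.

(* Matrices over [A] as a real vector space. *)
Definition hmat (R : realType) (A : cstarAlgType R) (n : nat) : Type := 'I_n -> 'I_n -> A.

Section HMatModule.
Variables (R : realType) (A : cstarAlgType R) (n : nat).
Implicit Types (x y : hmat A n).

HB.instance Definition _ := GRing.Zmodule.copy (hmat A n) ('I_n -> 'I_n -> A).

Definition hmat_scale (a : R) x : hmat A n := fun i j => a%:C%C *: x i j.

Let scaleA (a b : R) x : hmat_scale a (hmat_scale b x) = hmat_scale (a * b) x.
Proof. by apply/funext => i; apply/funext => j; rewrite /hmat_scale scalerA rmorphM. Qed.

Let scale1 : left_id 1 hmat_scale.
Proof. by move=> x; apply/funext => i; apply/funext => j; rewrite /hmat_scale scale1r. Qed.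

Let scaleDr : right_distributive hmat_scale +%R.
Proof. by move=> a x y; apply/funext => i; apply/funext => j; exact: scalerDr. Qed.

Let scaleDl x : {morph hmat_scale^~ x : a b / a + b}.
Proof.
move=> a b; apply/funext => i; apply/funext => j.
by rewrite /hmat_scale rmorphD scalerDl.
Qed.

HB.instance Definition _ := GRing.Zmodule_isLmodule.Build R (hmat A n)
  scaleA scale1 scaleDr scaleDl.

Lemma hmat_scaleE (a : R) x i j : (a *: x) i j = a%:C%C *: x i j. Proof. by []. Qed.
Lemma hmat_addE x y i j : (x + y) i j = x i j + y i j. Proof. by []. Qed.
Lemma hmat_oppE x i j : (- x) i j = - x i j. Proof. by []. Qed.

Definition hmat_star x : hmat A n := fun i j => star (x j i).

(** This is the matrix product of the adjoint of [b] with [b]. A rectangular [b] makes sums of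
    squares single Gram matrices, by stacking rows. *)
Definition gram m (b : 'I_m -> 'I_n -> A) : hmat A n :=
  fun i j => \sum_k cmul (star (b k i)) (b k j).

Definition sos : set (hmat A n) := [set x | exists m (b : 'I_m -> 'I_n -> A), x = gram b].

(* This cone contains all skew-adjoint matrices, so a real functional positive on
   it is determined by its values on hermitian ones. *)
Definition hmat_cone : set (hmat A n) := [set x | sos (x + hmat_star x)].

Definition hmat_unit : hmat A n := fun i j => if i == j then cone A else 0.

Definition hmat_elt i j (a : A) : hmat A n :=
  fun k l => if (k == i) && (l == j) then a else 0.

Lemma hmatP x y : (forall i j, x i j = y i j) -> x = y.
Proof. by move=> xy; apply/funext => i; apply/funext => j. Qed.

Lemma sos0 : sos 0.
Proof.
exists 0, (fun i j => 0); apply: hmatP => i j.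
by rewrite /gram big_ord0.
Qed.

Lemma sosD x y : sos x -> sos y -> sos (x + y).
Proof.
move=> [m [b ->]] [k [c ->]].
exists (m + k), (fun l => match fintype.split l with inl i => b i | inr i => c i end).
apply: hmatP => i j; rewrite hmat_addE /gram big_split_ord/=; congr (_ + _).
  apply: eq_bigr => l _; case: fintype.splitP => /= l' ll'.
    by have -> : l = l' by exact: val_inj.
  by have := ltn_ord l; rewrite ll' ltnNge leq_addr.
apply: eq_bigr => l _; case: fintype.splitP => /= l' ll'.
  by have := ltn_ord l'; rewrite -ll' ltnNge leq_addr.
by have -> : l = l' by apply: val_inj; exact: addnI ll'.
Qed.

Lemma sosZ (a : R) x : 0 <= a -> sos x -> sos (a *: x).
Proof.
move=> a0 [m [b ->]]; pose t := sqrtC a%:C%C; exists m, (fun k i => t *: b k i).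
apply: hmatP => i j; rewrite hmat_scaleE /gram scaler_sumr; apply: eq_bigr => k _.
rewrite starZ cmulZl cmulZr scalerA conj_Creal ?ger0_real ?sqrtC_ge0 ?lecR//.
by rewrite -expr2 sqrtCK.
Qed.

Lemma sos_diag (d : 'I_n -> A) : (forall i, exists b, d i = cmul (star b) b) ->
  sos (fun i j => if i == j then d i else 0).
Proof.
move=> /choice[b dE]; exists n, (fun k i => if k == i then b k else 0).
apply: hmatP => i j; rewrite /gram (bigD1 i)//= eqxx big1 ?addr0.
  by case: eqP => _; rewrite ?dE// cmul0r.
by move=> k /negbTE ->; rewrite star0 cmul0l.
Qed.

Lemma sos_unit : sos hmat_unit.
Proof. by apply: sos_diag => i; exists (cone A); rewrite star1 cmul1l. Qed.

Lemma hmat_starD x y : hmat_star (x + y) = hmat_star x + hmat_star y.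
Proof. by apply: hmatP => i j; exact: starD. Qed.

Lemma hmat_starN x : hmat_star (- x) = - hmat_star x.
Proof. by apply: hmatP => i j; exact: starN. Qed.

Lemma hmat_starZ (a : R) x : hmat_star (a *: x) = a *: hmat_star x.
Proof.
apply: hmatP => i j; rewrite /hmat_star !hmat_scaleE starZ conj_Creal//.
by apply/complex_realP; exists a.
Qed.

Lemma hmat_star_unit : hmat_star hmat_unit = hmat_unit.
Proof.
by apply: hmatP => i j; rewrite /hmat_star /hmat_unit eq_sym; case: eqP => _; rewrite ?star1 ?star0.
Qed.

(* With [v] the row [e_i - a e_j], [v^* v = E_ii - a E_ij - a^* E_ji + a^* a E_jj]. *)
Lemma hmat_elt_bound i j a : exists r : R, hmat_cone (r *: hmat_unit - hmat_elt i j a).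
Proof.
have sqs : star (cmul (star a) a) = cmul (star a) a by rewrite starM starK.
have [s [b [s0 bE]]] := scaled_unit_sub_square sqs.
(* The cone symmetrises, which doubles the unit, hence the half. What remains after removing
   [gram v] is diagonal: [d1] is the unit minus [E_ii], and [d2] is [s] times the unit minus
   [a^* a E_jj], a square in each entry by the choice of [s]. *)
exists ((1 + s) / 2); rewrite /hmat_cone/= hmat_starD hmat_starN hmat_starZ hmat_star_unit.
pose v : 'I_1 -> 'I_n -> A := fun _ k => (if k == i then cone A else 0) - (if k == j then a else 0).
pose d1 k := if k == i then 0 else cone A.
pose d2 k := if k == j then cmul (star b) b else s%:C%C *: cone A.
have sos1 : sos (fun k l => if k == l then d1 k else 0).
  apply: sos_diag => k; rewrite /d1; case: eqP => _; first by exists 0; rewrite cmul0r.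
  by exists (cone A); rewrite star1 cmul1l.
have sos2 : sos (fun k l => if k == l then d2 k else 0).
  apply: sos_diag => k; rewrite /d2; case: eqP => _; first by exists b.
  have sC0 : 0 <= s%:C%C :> R[i] by rewrite lecR.
  exists (sqrtC s%:C%C *: cone A); rewrite starZ star1 cmulZl cmulZr cmul1l scalerA.
  by rewrite conj_Creal ?ger0_real ?sqrtC_ge0// -expr2 sqrtCK.
have sos3 : sos (gram v) by exists 1, v.
rewrite (_ : _ + _ = (fun k l => if k == l then d1 k else 0) +
  (fun k l => if k == l then d2 k else 0) + gram v); first by do 2![apply: sosD => //].
apply: hmatP => k l; rewrite !hmat_addE !hmat_oppE hmat_scaleE /gram big_ord1.
rewrite addrACA -scalerDl -rmorphD -splitr rmorphD/= scalerDl scale1r.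
rewrite /hmat_star /hmat_elt /hmat_unit /v /d1 /d2 -bE.
have starE := (@starB, @starN, @star1, @star0).
have cmulE := (@cmulBl, @cmulBr, @cmulNl, @cmulNr, @cmul0r, @cmul0l, @cmul1l, @cmul1r).
have zE := (@scaler0, @subr0, @sub0r, @opprK, @addr0, @add0r, @oppr0).
have [<-{l}|kl] := eqVneq k l.
  case: (k == i); case: (k == j); rewrite /= !(starE, cmulE, zE) //.
  - have swap (p q y z w : A) : p + q + (- y - z) = q - w + (p - y - (z - w)).
      rewrite opprB [w - z]addrC [p - y + _]addrA -[RHS]addrA [_ + w]addrC addKr.
      by rewrite [p + q]addrC -!addrA.
    by rewrite [- a - star a]addrC; exact: swap.
  - by rewrite addrC.
  - by rewrite -addrA subrK.
have [ki|_] := eqVneq k i; have [kj|_] := eqVneq k j;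
  have [li|_] := eqVneq l i; have [lj|_] := eqVneq l j; try (by case/eqP: kl; congruence);
  by rewrite /= !(starE, cmulE, zE).
Qed.

Lemma hmat_sum_elt x : x = \sum_i \sum_j hmat_elt i j (x i j).
Proof.
apply: hmatP => k l; rewrite !fct_sumE (bigD1 k)//= !fct_sumE (bigD1 l)//=.
rewrite big1; last by move=> j /negbTE jl; rewrite /hmat_elt [l == j]eq_sym jl andbF.
rewrite big1; last first.
  move=> i /negbTE ik; rewrite !fct_sumE big1// => j _.
  by rewrite /hmat_elt [k == i]eq_sym ik.
by rewrite /hmat_elt !eqxx !addr0.
Qed.

Lemma hmat_coneD x y : hmat_cone x -> hmat_cone y -> hmat_cone (x + y).
Proof. by move=> Qx Qy; rewrite /hmat_cone/= hmat_starD addrACA; exact: sosD. Qed.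

Lemma hmat_order_unit : order_unit hmat_cone hmat_unit.
Proof.
split.
- rewrite /hmat_cone/= (_ : hmat_star 0 = 0) ?addr0; first exact: sos0.
  by apply: hmatP => i j; exact: star0.
- exact: hmat_coneD.
- by move=> c x c0 Qx; rewrite /hmat_cone/= hmat_starZ -scalerDr; exact: sosZ.
- by rewrite /hmat_cone/= hmat_star_unit; apply: sosD; exact: sos_unit.
- move=> x; rewrite [x]hmat_sum_elt.
  pose P x := exists r : R, hmat_cone (r *: hmat_unit - x).
  have PD x1 x2 : P x1 -> P x2 -> P (x1 + x2).
    move=> [r Pr] [t Pt]; exists (r + t); rewrite scalerDl opprD addrACA.
    exact: hmat_coneD.
  have P0 : P 0.
    exists 0; rewrite scale0r subr0 /hmat_cone/= (_ : hmat_star 0 = 0) ?addr0; first exact: sos0.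
    by apply: hmatP => i j; exact: star0.
  apply: (big_ind P) => // i _; apply: (big_ind P) => // j _.
  exact: hmat_elt_bound.
Qed.

End HMatModule.

(** * From real positive functionals to complex-linear ones *)

Section ComplexFunctional.
Variables (R : realType) (A : cstarAlgType R) (n : nat).
Implicit Types (x y : hmat A n).

Definition hmat_cscale (c : R[i]) x : hmat A n := fun i j => c *: x i j.

Definition hmat_outer (w v : 'I_n -> A) : hmat A n := fun i j => cmul (star (w i)) (v j).

Lemma hmat_cscaleE c x : hmat_cscale c x =
  complex.Re c *: x + complex.Im c *: hmat_cscale 'i%C x.
Proof.
apply: hmatP => i j; rewrite hmat_addE !hmat_scaleE /hmat_cscale scalerA -scalerDl.
by rewrite {1}[c]complexE [in RHS]mulrC.
Qed.

Lemma hmat_cscaleD c x y : hmat_cscale c (x + y) = hmat_cscale c x + hmat_cscale c y.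
Proof. by apply: hmatP => i j; exact: scalerDr. Qed.

Lemma hmat_starK : involutive (@hmat_star R A n).
Proof. by move=> x; apply: hmatP => i j; exact: starK. Qed.

Lemma hmat_star_cscale c x : hmat_star (hmat_cscale c x) = hmat_cscale c^* (hmat_star x).
Proof. by apply: hmatP => i j; exact: starZ. Qed.

Lemma star_sum (I : finType) (f : I -> A) : star (\sum_i f i) = \sum_i star (f i).
Proof. by elim/big_rec2: _ => [|i x y _ <-]; rewrite ?star0 ?starD. Qed.

Lemma hmat_star_gram m (b : 'I_m -> 'I_n -> A) : hmat_star (gram b) = gram b.
Proof.
apply: hmatP => i j; rewrite /hmat_star /gram star_sum; apply: eq_bigr => k _.
by rewrite starM starK.
Qed.

Lemma hmat_cone_gram m (b : 'I_m -> 'I_n -> A) : hmat_cone (gram b).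
Proof. by rewrite /hmat_cone/= hmat_star_gram; apply: sosD; exists m, b. Qed.

Variable G : {scalar hmat A n}.
Hypothesis Gpos : positive (@hmat_cone R A n) G.

Lemma positive_star x : G (hmat_star x) = G x.
Proof.
have h y : 0 <= G (y - hmat_star y).
  apply: Gpos; rewrite /hmat_cone/= hmat_starD hmat_starN hmat_starK.
  by rewrite -(opprB y) subrr; exact: sos0.
apply/eqP; rewrite -subr_eq0 -linearB; apply/eqP/le_anti; apply/andP; split.
  by rewrite -oppr_ge0 -linearN opprB h.
by have := h (hmat_star x); rewrite hmat_starK.
Qed.

(** The complex-linear functional whose real part is [G]. *)
Definition complexify x : R[i] := (G x +i* - G (hmat_cscale 'i%C x))%C.

Lemma complexifyD x y : complexify (x + y) = complexify x + complexify y.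
Proof.
by apply/eqP; rewrite eq_complex/= hmat_cscaleD !linearD/= !eqxx.
Qed.

Lemma complexifyZ c x : complexify (hmat_cscale c x) = c * complexify x.
Proof.
have E (a b : R) y : hmat_cscale (a +i* b)%C y = a *: y + b *: hmat_cscale 'i%C y.
  exact: hmat_cscaleE.
have Z (r : R) y : hmat_cscale 'i%C (r *: y) = r *: hmat_cscale 'i%C y.
  by apply: hmatP => i j; rewrite !hmat_scaleE /hmat_cscale !hmat_scaleE !scalerA mulrC.
have I y : hmat_cscale 'i%C (hmat_cscale 'i%C y) = - y.
  by apply: hmatP => i j; rewrite hmat_oppE -scaleN1r /hmat_cscale scalerA; congr (_ *: _); exact: sqr_i.
case: c => a b; apply/eqP; rewrite eq_complex/= !(E a b) hmat_cscaleD !Z I.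
have GD y z : G (y + z) = G y + G z by rewrite linearD.
have GZ r y : G (r *: y) = r * G y by rewrite linearZ.
rewrite !GD !GZ linearN/=.
by apply/andP; split; apply/eqP; ring.
Qed.

Lemma complexify0 : complexify 0 = 0.
Proof. by apply: (addrI (complexify 0)); rewrite -complexifyD !addr0. Qed.

Lemma complexify_sum (I : finType) (x : I -> hmat A n) :
  complexify (\sum_i x i) = \sum_i complexify (x i).
Proof. by elim/big_rec2: _ => [|i y z _ <-]; [exact: complexify0|exact: complexifyD]. Qed.

Lemma complexify_star x : complexify (hmat_star x) = (complexify x)^*.
Proof.
rewrite /complexify positive_star.
have -> : hmat_cscale 'i%C (hmat_star x) = - hmat_star (hmat_cscale 'i%C x).
  rewrite hmat_star_cscale; apply: hmatP => i j.
  by rewrite hmat_oppE -scaleN1r /hmat_cscale scalerA mulN1r; congr (_ *: _); simpc.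
by rewrite linearN/= positive_star; simpc.
Qed.

Lemma complexify_gram m (b : 'I_m -> 'I_n -> A) : 0 <= complexify (gram b).
Proof.
have G0 : 0 <= G (gram b) by apply: Gpos; exact: hmat_cone_gram.
have : complexify (gram b) \is Num.real.
  by rewrite CrealE -complexify_star hmat_star_gram.
move=> /complex_realP[r]; rewrite /complexify => -[rE ->].
by rewrite lecE/= eqxx.
Qed.

End ComplexFunctional.

(** * The GNS construction *)

Section GNS.
Variables (R : realType) (A : cstarAlgType R) (n : nat).
Local Notation vec := ('I_n -> A).
Implicit Types (v w : 'I_n -> A) (a b : A).

Definition lact a v : vec := fun i => cmul a (v i).

Definition basis_vec j : vec := fun i => if i == j then cone A else 0.

Lemma lactM a b v : lact (cmul a b) v = lact a (lact b v).
Proof. by apply/funext => i; rewrite /lact cmulA. Qed.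

Lemma hmat_outer_linear w c v v' :
  hmat_outer w (c *: v + v') = hmat_cscale c (hmat_outer w v) + hmat_outer w v'.
Proof.
by apply: hmatP => i j; rewrite hmat_addE /hmat_cscale /hmat_outer cmulDr cmulZr.
Qed.

Lemma hmat_star_outer v w : hmat_star (hmat_outer v w) = hmat_outer w v.
Proof. by apply: hmatP => i j; rewrite /hmat_star /hmat_outer starM starK. Qed.

Lemma hmat_outer_gram v : hmat_outer v v = gram (fun _ : 'I_1 => v).
Proof. by apply: hmatP => i j; rewrite /gram big_ord1. Qed.

Lemma vec_sum v : v = \sum_j lact (v j) (basis_vec j).
Proof.
apply/funext => i; rewrite fct_sumE (bigD1 i)//= big1 ?addr0.
  by rewrite /lact /basis_vec eqxx cmul1r.
by move=> j ji; rewrite /lact /basis_vec eq_sym (negbTE ji) cmul0r.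
Qed.

Variable G : {scalar hmat A n}.
Hypothesis Gpos : positive (@hmat_cone R A n) G.
Local Notation F := (complexify G).

Let form v w : R[i] := F (hmat_outer w v).

Let formP w : scalar (form^~ w).
Proof.
by move=> c v v'; rewrite /form hmat_outer_linear complexifyD complexifyZ.
Qed.

Let formC v w : form w v = (form v w)^*.
Proof. by rewrite /form -complexify_star// hmat_star_outer. Qed.

Let form_ge0 v : 0 <= form v v.
Proof. by rewrite /form hmat_outer_gram complexify_gram. Qed.

Definition gns : semidot vec := SemiDot formP formC form_ge0.

Lemma gns_lact a v w : gns (lact a v) w = gns v (lact (star a) w).
Proof.
rewrite /gns/= /form; congr (F _); apply: hmatP => i j.
by rewrite /hmat_outer /lact starM starK cmulA.
Qed.

(** With [s - a^* a = b^* b], the difference of the squared norms, [s] times that of [v] minus that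
    of [lact a v], is the squared norm of [lact b v]. *)
Lemma gns_lact_bound a : exists2 s, 0 <= s &
  forall v, snorm gns (lact a v) <= s * snorm gns v.
Proof.
have sqs : star (cmul (star a) a) = cmul (star a) a by rewrite starM starK.
have [s [b [s0 bE]]] := scaled_unit_sub_square sqs.
have sC0 : 0 <= s%:C%C :> R[i] by rewrite lecR.
exists (sqrtC s%:C%C) => [|v]; first by rewrite sqrtC_ge0.
apply: snorm_le; first by rewrite mulr_ge0 ?snorm_ge0// sqrtC_ge0.
rewrite exprMn sqrtCK sqr_snorm -subr_ge0.
have -> : s%:C%C * gns v v - gns (lact a v) (lact a v) = gns (lact b v) (lact b v).
  rewrite [gns (lact b v) _]gns_lact [gns (lact a v) _]gns_lact -!lactM -bE.
  have -> : lact (s%:C%C *: cone A - cmul (star a) a) v = s%:C%C *: v - lact (cmul (star a) a) v.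
    apply/funext => i; rewrite /lact.
    by rewrite cmulBl cmulZl cmul1l.
  rewrite sformBr sformZr conj_Creal//; exact: ger0_real.
exact: sform_ge0.
Qed.

Local Notation K := (completion gns).
Implicit Types (f g h : K).

(** An element [f] of the completion is the functional of its products with vectors of [A^n], so the
    action is prescribed by the adjoint relation. *)
Definition gns_act a f : vec -> R[i] := fun w => f (lact (star a) w).

Lemma gns_actP a f : gns_act a f \in approximable gns.
Proof.
have [s s0 sP] := gns_lact_bound (star a).
have s1 : 0 < s + 1 by rewrite ltr_wpDl.
apply/approximableP => e e0.
have [v fv] := cfun_exists f (divr_gt0 e0 s1); exists (lact a v) => w.
rewrite gns_lact (le_trans (fv _))// (le_trans (ler_wpM2l _ (sP _)))//.
  by rewrite divr_ge0 ?ltW.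
rewrite mulrA ler_wpM2r ?snorm_ge0// mulrAC ler_pdivrMr// ler_wpM2l ?lerDl//.
exact: ltW.
Qed.

Lemma gns_rep_exists : exists pi : A -> 'B(K), forall a f w, pi a f w = f (lact (star a) w).
Proof.
suff /choice[pi piE] : forall a, exists S : 'B(K), forall f, S f = Completion (gns_actP a f).
  by exists pi => a f w; rewrite piE.
move=> a; have [s s0 sP] := gns_lact_bound (star a).
apply: (exists_bounded_op s0).
  by move=> c f g; apply/val_inj/funext => w.
move=> f; apply: norm_le_cfun; first by rewrite mulr_ge0.
move=> w; rewrite [leLHS]/= /gns_act (le_trans (cfun_le_norm _ _))//.
by rewrite [s * _]mulrC -mulrA ler_wpM2l.
Qed.

Lemma embed_dense f e : 0 < e -> exists v, `|f - embed gns v| <= e.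
Proof.
move=> e0; have [v fv] := cfun_exists f e0; exists v.
by apply: norm_le_cfun; [exact: ltW|exact: fv].
Qed.

Variable pi : A -> 'B(K).
Hypothesis piE : forall a f w, pi a f w = f (lact (star a) w).

Lemma pi_embed a v : pi a (embed gns v) = embed gns (lact a v).
Proof.
apply/val_inj/funext => w; transitivity (gns v (lact (star a) w)); first exact: piE.
by rewrite -gns_lact.
Qed.

Lemma pi_bound a : exists2 s, 0 <= s & forall f, `|pi a f| <= s * `|f|.
Proof.
have [s s0 sP] := gns_lact_bound (star a); exists s => // f.
apply: norm_le_cfun; first by rewrite mulr_ge0.
move=> w; rewrite piE (le_trans (cfun_le_norm _ _))//.
by rewrite [s * _]mulrC -mulrA ler_wpM2l.
Qed.

Lemma gns_representation : representation pi.
Proof.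
split=> [c a b f|a b f|f|a f g].
- apply/val_inj/funext => w; rewrite [LHS]piE [RHS]cfun_scaleD !piE.
  have -> : lact (star (c *: a + b)) w = c^* *: lact (star a) w + lact (star b) w.
    by apply/funext => i; rewrite /lact starD starZ cmulDl cmulZl.
  by rewrite cfun_antilinear conjCK.
- by apply/val_inj/funext => w; rewrite [LHS]piE [RHS]piE piE starM lactM.
- apply/val_inj/funext => w; rewrite [LHS]piE star1; congr (_ _).
  by apply/funext => i; rewrite /lact cmul1l.
(* Against embedded vectors the adjoint relation is a computation; their density and the bounds on
   [pi a] and [pi (star a)] extend it to every [g]. *)
have emb v : '[pi (star a) f, embed gns v] = '[f, pi a (embed gns v)].
  by rewrite pi_embed [LHS]cdot_embed [RHS]cdot_embed piE starK.
have [s s0 sP] := pi_bound (star a); have [t t0 tP] := pi_bound a.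
apply/eqP; rewrite -subr_eq0; apply/eqP.
apply: (@ler_epsilon_eq0 _ _ ((s + t) * `|f|)) => [|e e0 _].
  by rewrite mulr_ge0 ?addr_ge0.
have [v gv] := embed_dense g e0.
have -> : '[pi (star a) f, g] - '[f, pi a g] =
    '[pi (star a) f, g - embed gns v] - '[f, pi a (g - embed gns v)].
  have -> : pi a (g - embed gns v) = pi a g - pi a (embed gns v) by rewrite linearB.
  rewrite !hdotE !sformBr -!hdotE emb.
  by rewrite opprB addrA subrK.
rewrite (le_trans (ler_normB _ _))// -mulrA mulrDl lerD//.
  rewrite (le_trans (sform_CauchySchwarz (hilbert_semidot K) _ _))// -!hilbert_normE.
  by rewrite mulrA; apply: ler_pM => //; exact: sP.
rewrite (le_trans (sform_CauchySchwarz (hilbert_semidot K) _ _))// -!hilbert_normE.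
rewrite mulrCA; apply: ler_wpM2l => //; apply: (le_trans (tP _)).
exact: ler_wpM2l.
Qed.

End GNS.

(** * Vector functionals of a representation *)

Section RepresentationForm.
Variables (R : realType) (A : cstarAlgType R) (n : nat).
Variables (K : hilbertType R) (pi : A -> 'B(K)).
Hypothesis repr : representation pi.
Implicit Types (x y : hmat A n) (eta : 'I_n -> K).
Local Notation D := (hilbert_semidot K).

Lemma repr0 z : pi 0 z = 0.
Proof.
have := repr_linear repr (-1) 0 0 z; rewrite scaler0 addr0 scaleN1r.
by rewrite addNr.
Qed.

Lemma repr_sum (I : finType) (a : I -> A) z : pi (\sum_i a i) z = \sum_i pi (a i) z.
Proof.
elim/big_rec2: _ => [|i u v _ <-]; first exact: repr0.
by have := repr_linear repr 1 (a i) v z; rewrite !scale1r.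
Qed.

(** The vector functional, at [eta] in [K^n], of the amplification of [pi] to [M_n(A)]. *)
Definition repr_form eta x : R[i] := \sum_i \sum_j '[pi (x i j) (eta j), eta i].

Lemma repr_form_linear eta c x y :
  repr_form eta (hmat_cscale c x + y) = c * repr_form eta x + repr_form eta y.
Proof.
rewrite /repr_form mulr_sumr -big_split/=; apply: eq_bigr => i _.
rewrite mulr_sumr -big_split/=; apply: eq_bigr => j _.
by rewrite hmat_addE /hmat_cscale (repr_linear repr) hdotE sformDl sformZl.
Qed.

Lemma repr_form_star eta x : repr_form eta (hmat_star x) = (repr_form eta x)^*.
Proof.
rewrite /repr_form rmorph_sum/= exchange_big/=; apply: eq_bigr => i _.
rewrite rmorph_sum/=; apply: eq_bigr => j _.
by rewrite /hmat_star (repr_star repr) hdotE sformC.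
Qed.

Lemma repr_form_gram eta m (b : 'I_m -> 'I_n -> A) : repr_form eta (gram b) =
  \sum_k '[\sum_j pi (b k j) (eta j), \sum_j pi (b k j) (eta j)].
Proof.
rewrite /repr_form; under eq_bigr do under eq_bigr do rewrite /gram repr_sum hdotE sform_suml.
under eq_bigr do rewrite exchange_big/=.
rewrite exchange_big/=; apply: eq_bigr => k _.
rewrite hdotE sform_sumr; apply: eq_bigr => i _.
rewrite sform_suml; apply: eq_bigr => j _.
by rewrite -!hdotE (repr_mul repr) (repr_star repr).
Qed.

Lemma Re_repr_form_scalar eta : scalar (fun x => complex.Re (repr_form eta x)).
Proof.
move=> r x y; have -> : r *: x = hmat_cscale r%:C%C x by [].
rewrite repr_form_linear raddfD/=; congr (_ + _).
by case: (repr_form eta x) => u v; simpc.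
Qed.

Lemma Re_repr_form_positive eta :
  positive (@hmat_cone R A n) (fun x => complex.Re (repr_form eta x)).
Proof.
move=> x [m [b xb]].
have : 0 <= repr_form eta (x + hmat_star x).
  by rewrite xb repr_form_gram sumr_ge0// => k _; exact: dnorm_ge0.
have -> : x + hmat_star x = hmat_cscale 1 x + hmat_star x.
  by congr (_ + _); apply: hmatP => i j; rewrite /hmat_cscale scale1r.
rewrite repr_form_linear repr_form_star mul1r.
case: (repr_form eta x) => u v; rewrite lecE/= => /andP[_].
by rewrite -mulr2n pmulrn_lge0.
Qed.

End RepresentationForm.

Section GNSForm.
Variables (R : realType) (A : cstarAlgType R) (n : nat).
Variable G : {scalar hmat A n}.
Hypothesis Gpos : positive (@hmat_cone R A n) G.
Local Notation B := (gns Gpos).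
Local Notation K := (completion B).
Variable pi : A -> 'B(K).
Hypothesis piE : forall a f w, pi a f w = f (lact (star a) w).

Definition gns_basis j : K := embed B (basis_vec A j).

Lemma outer_basis (i j : 'I_n) (a : A) :
  hmat_outer (basis_vec A i) (lact a (basis_vec A j)) = hmat_elt i j a.
Proof.
apply: hmatP => k l; rewrite /hmat_outer /lact /basis_vec /hmat_elt.
case: (k == i); case: (l == j).
- by rewrite star1 cmul1l cmul1r.
- by rewrite cmul0r cmul0r.
- by rewrite star0 cmul0l.
- by rewrite star0 cmul0l.
Qed.

Lemma gns_form_elt (i j : 'I_n) (a : A) :
  '[pi a (gns_basis j), gns_basis i] = complexify G (hmat_elt i j a).
Proof. by rewrite (pi_embed piE) [LHS]cdot_embed -outer_basis. Qed.

Lemma gns_repr_form x : repr_form pi gns_basis x = complexify G x.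
Proof.
rewrite [in RHS](hmat_sum_elt x) complexify_sum; apply: eq_bigr => i _.
by rewrite complexify_sum; apply: eq_bigr => j _; exact: gns_form_elt.
Qed.

Lemma embed_sum (I : finType) (f : I -> 'I_n -> A) :
  embed B (\sum_i f i) = \sum_i embed B (f i).
Proof.
have eL := @embed_linear _ _ B.
elim/big_rec2: _ => [|i u v _ <-].
  by have := eL (-1) 0 0; rewrite scaler0 addr0 scaleN1r addNr.
by have := eL 1 (f i) v; rewrite !scale1r.
Qed.

(** Joint cyclicity of the basis classes: the orbits of the [gns_basis j] span the dense space of
    embedded vectors. *)
Lemma gns_embedE v : embed B v = \sum_j pi (v j) (gns_basis j).
Proof.
rewrite {1}(vec_sum v) embed_sum; apply: eq_bigr => j _.
by rewrite (pi_embed piE).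
Qed.

End GNSForm.

(** * Purity implies irreducibility *)

Section PureIrreducible.
Variables (R : realType) (A : cstarAlgType R) (n : nat).
Variable G : {scalar hmat A n}.
Hypothesis Gpos : positive (@hmat_cone R A n) G.
Hypothesis Gpure : pure (@hmat_cone R A n) (@hmat_unit R A n) G.
Local Notation B := (gns Gpos).
Local Notation K := (completion B).

Variable pi : A -> 'B(K).
Hypothesis piE : forall a f w, pi a f w = f (lact (star a) w).
Let repr : representation pi := gns_representation piE.
Local Notation xi := (gns_basis Gpos).

(** The projection [P] onto an invariant [W] commutes with [pi], so splitting [xi] into [P xi] and
    its complement splits [G] into two positive functionals. By purity the first is [c] times [G];
    cyclicity then makes [P] the scalar [c] on embedded vectors, and idempotence leaves [c = 0] or
    [c = 1]. *)
Lemma gns_irreducible : irreducible pi.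
Proof.
have form_xi x : complexify G x = repr_form pi xi x by rewrite (gns_repr_form piE).
split.
  apply: contrapT => K0.
  have all0 (z : K) : z = 0.
    by apply: contrapT => z0; apply: K0; exists z; apply/eqP.
  have : complexify G (@hmat_unit R A n) = 0.
    rewrite form_xi /repr_form big1// => i _; rewrite big1// => j _.
    by rewrite [xi i]all0 hdotE sform0r.
  move=> /(congr1 (@complex.Re R)) /=; have [_ -> _] := Gpure.
  by move/eqP; rewrite oner_eq0.
move=> W Wsub Wcl Wpi.
have [W0 WP] := Wsub.
have [P Pproj] := orth_proj_exists Wsub (fun x => orthogonal_projection x Wsub Wcl).
have WN x : W x -> forall z, '[z - P z, x] = 0.
  by move=> Wx z; have [_] := Pproj z; apply.
have WPz z : W (P z) by have [] := Pproj z.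
have Puniq z y := @orth_proj_eq _ _ W P z y Wsub Pproj.
have Pid w : W w -> P w = w.
  by move=> Ww; apply: Puniq => // w' _; rewrite subrr hdotE sform0l.
have Ppi a z : P (pi a z) = pi a (P z).
  apply: Puniq; first exact: Wpi.
  move=> w Ww; rewrite -linearB/= -[a in pi a]starK (repr_star repr).
  by apply: WN; exact: Wpi.
pose eta j := P (xi j).
have [zeta zetaE] : {z : 'I_n -> K | forall j, z j = xi j - eta j}.
  by exists (fun j => xi j - eta j).
have zetaW j w : W w -> '[w, zeta j] = 0.
  by move=> Ww; rewrite zetaE hdotE sformC -hdotE WN// rmorph0.
have split_form x : repr_form pi xi x = repr_form pi eta x + repr_form pi zeta x.
  rewrite /repr_form -big_split/=; apply: eq_bigr => i _.
  rewrite -big_split/=; apply: eq_bigr => j _.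
  have xiE k : xi k = eta k + zeta k by rewrite zetaE addrC subrK.
  have c1 : '[pi (x i j) (eta j), zeta i] = 0.
    by apply: zetaW; apply: Wpi; exact: WPz.
  have c2 : '[pi (x i j) (zeta j), eta i] = 0.
    by rewrite -[x i j]starK (repr_star repr) zetaE WN//; apply: Wpi; exact: WPz.
  have piD : pi (x i j) (xi j) = pi (x i j) (eta j) + pi (x i j) (zeta j).
    by rewrite {1}xiE linearD.
  by rewrite piD (xiE i) !hdotE sformDl !sformDr -!hdotE c1 c2 addr0 add0r.
have eta_form x : repr_form pi eta x = \sum_i \sum_j '[P (pi (x i j) (xi j)), xi i].
  rewrite /repr_form; apply: eq_bigr => i _; apply: eq_bigr => j _.
  have xiE : xi i = zeta i + eta i by rewrite zetaE subrK.
  rewrite Ppi xiE [RHS]hdotE sformDr -!hdotE.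
  by rewrite zetaW ?add0r//; apply: Wpi; exact: WPz.
have [_ _ /(_ (scalar_of (Re_repr_form_scalar repr eta)))] := Gpure.
case.
- exact: Re_repr_form_positive.
- move=> x Qx /=.
  have -> : G x = complex.Re (repr_form pi xi x) by rewrite -form_xi.
  rewrite split_form raddfD/= addrAC subrr add0r.
  exact: (Re_repr_form_positive repr zeta Qx).
move=> c cE.
have repr_formZ theta a x : repr_form pi theta (hmat_cscale a x) = a * repr_form pi theta x.
  have := repr_form_linear repr theta a x 0; rewrite addr0 => ->.
  rewrite [X in _ + X](_ : _ = 0) ?addr0// /repr_form big1// => i _; rewrite big1// => j _.
  by rewrite (repr0 repr) hdotE sform0l.
(* Purity compares real parts only; its instance at ['i] times [x] compares the imaginary parts. *)
have ctot x : repr_form pi eta x = c%:C%C * repr_form pi xi x.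
  have h y : complex.Re (repr_form pi eta y) = c * complex.Re (repr_form pi xi y).
    by rewrite -form_xi; exact: (cE y).
  have := h (hmat_cscale 'i%C x); rewrite !repr_formZ.
  have := h x; case: (repr_form pi eta x) => a b; case: (repr_form pi xi x) => a' b' /=.
  rewrite !mul0r !mul1r !sub0r mulrN => -> /oppr_inj ->.
  by simpc.
have Pembed v : P (embed B v) = c%:C%C *: embed B v.
  apply/val_inj/funext => v'.
  transitivity ('[P (embed B v), embed B v']); first by rewrite [RHS]cdot_embed.
  transitivity (c%:C%C * repr_form pi xi (hmat_outer v' v)); last by rewrite -form_xi.
  rewrite -ctot eta_form (gns_embedE piE v) (gns_embedE piE v').
  have -> : P (\sum_j pi (v j) (xi j)) = \sum_j P (pi (v j) (xi j)) by exact: linear_sum.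
  rewrite hdotE sform_sumr; apply: eq_bigr => i _.
  rewrite sform_suml; apply: eq_bigr => j _.
  by rewrite /hmat_outer (repr_mul repr) (Ppi (star (v' i))) (repr_star repr).
have [emb0|[v v0]] : (forall v, embed B v = 0) \/ exists v, embed B v != 0.
  have [|h] := pselect (exists v, embed B v != 0); first by right.
  by left=> v; apply: contrapT => v0; apply: h; exists v; apply/eqP.
  left; apply/seteqP; split=> [w _ /=|w ->//]; apply/val_inj/funext => v /=.
  by rewrite -cdot_embed emb0 [LHS](@sform0r _ _ (cdot_semidot B)).
have : c%:C%C * c%:C%C = c%:C%C :> R[i].
  have := Pid _ (WPz (embed B v)); rewrite {1}Pembed linearZ/= Pembed scalerA.
  move=> /eqP; rewrite -subr_eq0 -scalerBl scaler_eq0 (negbTE v0) orbF subr_eq0.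
  by move/eqP.
move=> /eqP; rewrite -subr_eq0 -[X in _ - X]mulr1 -mulrBr mulf_eq0 => /orP[/eqP c0|].
  left; apply/seteqP; split=> [w Ww /=|w ->//].
  apply/val_inj/funext => v' /=; rewrite -cdot_embed.
  have := WN w Ww (embed B v'); rewrite Pembed c0 scale0r subr0.
  by rewrite hdotE sformC -hdotE => /(congr1 Num.conj); rewrite conjCK rmorph0.
rewrite subr_eq0 => /eqP c1; right; apply/seteqP; split=> // f _.
have -> : f = P f; last exact: WPz.
apply/eqP; rewrite -subr_eq0; apply/eqP/val_inj/funext => v'.
transitivity ('[f - P f, embed B v']); first by rewrite [RHS]cdot_embed.
apply: WN.
by have := WPz (embed B v'); rewrite Pembed c1 scale1r.
Qed.

End PureIrreducible.

(** * The dilation *)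

Section UcpFunctional.
Variables (R : realType) (A : cstarAlgType R) (S : set A) (H : hilbertType R).
Variables (phi : A -> 'B(H)) (n : nat) (e : 'I_n -> H).
Hypotheses (Sop : operator_system S) (phi_ucp : ucp S phi).
Implicit Types (x y : hmat A n) (c : R[i]).

Let S0 : S 0. Proof. by have [] := opsys_subspace Sop. Qed.

Let SP c a b : S a -> S b -> S (c *: a + b).
Proof. by have [_ h] := opsys_subspace Sop; exact: h. Qed.

Definition opsys_mx : set (hmat A n) := [set x | forall i j, S (x i j)].

Definition ucp_form x : R[i] := \sum_i \sum_j '[phi (x i j) (e j), e i].

Lemma opsys_mxP c x y : opsys_mx x -> opsys_mx y -> opsys_mx (hmat_cscale c x + y).
Proof. by move=> Sx Sy i j; exact: SP. Qed.

Lemma opsys_mx_star x : opsys_mx x -> opsys_mx (hmat_star x).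
Proof. by move=> Sx i j; exact: opsys_star. Qed.

Lemma opsys_mx0 : opsys_mx 0. Proof. by move=> i j; exact: S0. Qed.

Lemma opsys_mx_unit : opsys_mx (@hmat_unit R A n).
Proof.
by move=> i j; rewrite /hmat_unit; case: eqP => _; [exact: opsys_one Sop|exact: S0].
Qed.

Lemma opsys_mx_scale c x : opsys_mx x -> opsys_mx (hmat_cscale c x).
Proof. by move=> Sx; have := opsys_mxP c Sx opsys_mx0; rewrite addr0. Qed.

Lemma ucp_form_linear c x y : opsys_mx x -> opsys_mx y ->
  ucp_form (hmat_cscale c x + y) = c * ucp_form x + ucp_form y.
Proof.
move=> Sx Sy; rewrite /ucp_form mulr_sumr -big_split/=; apply: eq_bigr => i _.
rewrite mulr_sumr -big_split/=; apply: eq_bigr => j _.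
by rewrite hmat_addE /hmat_cscale (ucp_linear phi_ucp)// hdotE sformDl sformZl.
Qed.

(* [ucp_pos] speaks of squares [b^* b] of square matrices only, so the
   rectangular [b] is padded with zeros. *)
Lemma ucp_form_gram m (b : 'I_m -> 'I_n -> A) : opsys_mx (gram b) ->
  0 <= ucp_form (gram b).
Proof.
move=> Sb.
pose Y : 'M[cstar_ring A]_n := \matrix_(i, j) (gram b i j : cstar_ring A).
pose Bm : 'M[cstar_ring A]_(m, n) := \matrix_(i, j) (b i j : cstar_ring A).
pose s : 'M[cstar_ring A]_(n + m) := block_mx Y 0 0 0.
have Ss i j : S (s i j).
  rewrite /s; case: (fintype.splitP i) => i' ii; case: (fintype.splitP j) => j' jj.
  - have -> : i = lshift m i' by exact: val_inj.
    have -> : j = lshift m j' by exact: val_inj.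
    by rewrite block_mxEul mxE; exact: Sb.
  - have -> : i = lshift m i' by exact: val_inj.
    have -> : j = rshift n j' by exact: val_inj.
    by rewrite block_mxEur mxE; exact: S0.
  - have -> : i = rshift n i' by exact: val_inj.
    have -> : j = lshift m j' by exact: val_inj.
    by rewrite block_mxEdl mxE; exact: S0.
  - have -> : i = rshift n i' by exact: val_inj.
    have -> : j = rshift n j' by exact: val_inj.
    by rewrite block_mxEdr mxE; exact: S0.
have spos : mx_pos (s : 'M[cstar_ring A]_(n + m)).
  exists (block_mx 0 0 Bm 0).
  rewrite /star_mx tr_block_mx map_block_mx !trmx0.
  have m0 p q : map_mx (star : A -> A) (0 : 'M[cstar_ring A]_(p, q)) = 0 :> 'M[cstar_ring A]_(p, q).
    by apply/matrixP => i j; rewrite !mxE; exact: star0.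
  rewrite !m0 mulmx_block !mul0mx !mulmx0 !addr0 !add0r /s; congr block_mx.
  by apply/matrixP => i j; rewrite !mxE; apply: eq_bigr => k _; rewrite !mxE.
have := ucp_pos phi_ucp Ss spos.
move=> /(_ (fun i => match fintype.split i with inl j => e j | inr _ => 0 end)).
rewrite big_split_ord/= [X in _ + X]big1 ?addr0; last first.
  move=> i _; case: fintype.splitP => /= [k ik|k _]; last by rewrite hdotE sform0r.
  by have := ltn_ord k; rewrite -ik ltnNge leq_addr.
have splitl (i : 'I_n) : fintype.split (lshift m i) = inl i by exact: (unsplitK (inl i)).
have splitr (i : 'I_m) : fintype.split (rshift n i) = inr i by exact: (unsplitK (inr i)).
congr (_ <= _); apply: eq_bigr => i _; rewrite splitl.
rewrite hdotE sform_suml big_split_ord/= [X in _ + X]big1 ?addr0; last first.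
  by move=> j _; rewrite splitr linear0 hdotE sform0l.
by apply: eq_bigr => j _; rewrite splitl mxE block_mxEul mxE.
Qed.

Lemma ucp_form_scale c x : opsys_mx x -> ucp_form (hmat_cscale c x) = c * ucp_form x.
Proof.
have h0 : ucp_form 0 = 0.
  have := ucp_form_linear (-1) opsys_mx0 opsys_mx0; rewrite mulN1r addNr => <-.
  by congr ucp_form; apply: hmatP => i j; rewrite hmat_addE /hmat_cscale scaler0 addr0.
by move=> Sx; have := ucp_form_linear c Sx opsys_mx0; rewrite h0 !addr0.
Qed.

(** A hermitian [x] is a real combination of the unit and of a Gram matrix in [M_n(S)], and the form
    is nonnegative at both. *)
Lemma ucp_form_herm x : opsys_mx x -> hmat_star x = x -> ucp_form x \is Num.real.
Proof.
move=> Sx xs; pose u := @hmat_unit R A n.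
have [r [m [b zb]]] := cone_bound (hmat_order_unit A n) x.
have Su := opsys_mx_unit.
have Sxc := opsys_mx_scale (-2) Sx.
have zE : gram b = hmat_cscale (r%:C%C *+ 2) u + hmat_cscale (-2) x.
  rewrite -zb hmat_starD hmat_starN hmat_starZ hmat_star_unit xs.
  apply: hmatP => i j; rewrite !hmat_addE !hmat_oppE !hmat_scaleE /hmat_cscale.
  by rewrite scaleNr scaler_nat !mulr2n scalerDl opprD addrACA.
have [m0 [b0 ub]] := sos_unit A n.
have u_ge0 : 0 <= ucp_form u.
  by rewrite /u ub; apply: ucp_form_gram; rewrite -ub.
have := ucp_form_gram (_ : opsys_mx (gram b)); rewrite {1}zE => /(_ (opsys_mxP _ Su Sxc)).
rewrite zE ucp_form_linear// ucp_form_scale// => h.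
have -> : ucp_form x = 2^-1 * (r%:C%C *+ 2 * ucp_form u -
    (r%:C%C *+ 2 * ucp_form u + -2 * ucp_form x)) by field.
have rr : r%:C%C \is Num.real by apply/complex_realP; exists r.
apply: rpredM; first by rewrite realV realn.
apply: rpredB; last exact: ger0_real.
by rewrite rpredM ?rpredMn// ger0_real.
Qed.

(** The form is nonnegative at [x + x^*], which is a Gram matrix. It is real at the hermitian matrix
    [i (x - x^* )], which says that its real parts at [x] and at the adjoint of [x] agree. *)
Lemma Re_ucp_form_ge0 x : opsys_mx x -> hmat_cone x -> 0 <= complex.Re (ucp_form x).
Proof.
move=> Sx [m [b xb]].
have Sxs := opsys_mx_star Sx.
have x1 : x = hmat_cscale 1 x by apply: hmatP => i j; rewrite /hmat_cscale scale1r.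
have Sc := opsys_mx_scale (- 'i%C) Sxs.
have := ucp_form_herm (opsys_mxP 'i%C Sx Sc).
have -> : hmat_star (hmat_cscale 'i%C x + hmat_cscale (- 'i%C) (hmat_star x)) =
    hmat_cscale 'i%C x + hmat_cscale (- 'i%C) (hmat_star x).
  rewrite hmat_starD !hmat_star_cscale hmat_starK [LHS]addrC.
  by congr (hmat_cscale _ _ + hmat_cscale _ _); simpc.
move=> /(_ erefl) /complex_realP[r].
rewrite ucp_form_linear// ucp_form_scale//.
have := ucp_form_gram (_ : opsys_mx (gram b)).
rewrite -xb {1 3}x1 => /(_ (opsys_mxP 1 Sx Sxs)); rewrite ucp_form_linear// mul1r.
case: (ucp_form x) => a1 a2; case: (ucp_form (hmat_star x)) => b1 b2.
rewrite lecE/= => /andP[_ h] /(congr1 (@complex.Im R))/=; rewrite !(mul0r, mul1r, mulN1r, sub0r, oppr0, add0r, addr0).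
by move=> ab; lra.
Qed.

End UcpFunctional.

(** * Finite dimension of the GNS space of a sum of pure states *)

Section FiniteDimensionalGNS.
Variables (R : realType) (A : cstarAlgType R) (n : nat).
Hypothesis Afdi : fdi A.
Local Notation vec := ('I_n -> A).

(* [J] is indexed by [nat] so that its type does not depend on [N]. *)
Lemma pure_null_space (G : {scalar hmat A n}) : pure (@hmat_cone R A n) (@hmat_unit R A n) G ->
  exists N (J : nat -> vec -> R[i]), (forall i, scalar (J i)) /\
    forall v, (forall i, (i < N)%N -> J i v = 0) -> complexify G (hmat_outer v v) = 0.
Proof.
move=> Gpure; have [Gpos _ _] := Gpure.
have [pi piE] := gns_rep_exists Gpos.
have [N [e [_ eP]]] := Afdi (gns_representation piE) (gns_irreducible Gpure piE).
pose B := gns Gpos.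
(* Products with a spanning family of the finite-dimensional GNS space, and 0 from index [N] on. If
   they all vanish, the embedded vector is orthogonal to itself. *)
exists N, (fun i v => if insub i is Some k then '[embed B v, e k] else 0); split.
  move=> i a u v /=; case: insubP => [k _ _|_]; last by rewrite mulr0 addr0.
  by rewrite (embed_linear B) hdotE sformDl sformZl.
move=> v Jv; have [c vE] := eP (embed B v) I.
have : '[embed B v, embed B v] = 0.
  rewrite [X in '[_, X]]vE hdotE sform_sumr big1// => k _.
  by have := Jv k (ltn_ord k); rewrite valK sformZr -hdotE => ->; rewrite mulr0.
by rewrite [LHS]cdot_embed.
Qed.

Variables (m : nat) (t : 'I_m -> R) (G : 'I_m -> {scalar hmat A n}).
Hypotheses (t0 : forall k, 0 <= t k)
  (Gpure : forall k, pure (@hmat_cone R A n) (@hmat_unit R A n) (G k)).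
Variable F : {scalar hmat A n}.
Hypothesis FE : forall x, F x = \sum_k t k * G k x.

Lemma pure_sum_positive : positive (@hmat_cone R A n) F.
Proof.
move=> x Qx; rewrite FE sumr_ge0// => k _; apply: mulr_ge0 => //.
by have [h _ _] := Gpure k; exact: h.
Qed.

(** A vector null for every [G k] is null for their combination [F], and finitely many functionals
    cut out such vectors. The common bound [M] lets one finite index type serve all [k]; functionals
    beyond a state's own bound only add conditions. *)
Lemma finite_dim_gns : finite_dim [set: completion (gns pure_sum_positive)].
Proof.
have /choice[NJ NJP] : forall k, exists NJ : nat * (nat -> vec -> R[i]),
    (forall i, scalar (NJ.2 i)) /\
    forall v, (forall i, (i < NJ.1)%N -> NJ.2 i v = 0) -> complexify (G k) (hmat_outer v v) = 0.
  by move=> k; have [N [J JP]] := pure_null_space (Gpure k); exists (N, J).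
pose M := \max_k (NJ k).1.
have [|L [r rP]] := @exists_spanning R[i] vec ('I_m * 'I_M)%type (fun ki => (NJ ki.1).2 ki.2).
  by move=> [k i]; exact: (NJP k).1.
apply: (@finite_dim_completion _ _ _ _ r) => v; have [c cP] := rP v; exists c.
set z := v - _ in cP *.
have Gz k : complexify (G k) (hmat_outer z z) = 0.
  apply: (NJP k).2 => i iN.
  have iM : (i < M)%N by apply: leq_trans iN _; exact: leq_bigmax.
  exact: (cP (k, Ordinal iM)).
suff zz : complexify F (hmat_outer z z) = 0 by rewrite /snorm [gns _ _ _]zz sqrtC0.
have h k : G k (hmat_outer z z) = 0 /\ G k (hmat_cscale 'i%C (hmat_outer z z)) = 0.
  have := Gz k; rewrite /complexify => -[-> /eqP]; rewrite oppr_eq0 => /eqP ->.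
  by [].
rewrite /complexify !FE !big1 ?oppr0// => k _; last by rewrite (h k).1 mulr0.
by rewrite (h k).2 mulr0.
Qed.

End FiniteDimensionalGNS.

Section UcpExtension.
Variables (R : realType) (A : cstarAlgType R) (S : set A) (H : hilbertType R).
Variables (phi : A -> 'B(H)) (n : nat) (e : 'I_n -> H).
Hypotheses (Sop : operator_system S) (phi_ucp : ucp S phi) (Sfin : finite_dim S).

(** The span is over the reals, so each generator of [S] occurs together with its multiple by ['i];
    the boolean index tells them apart. *)
Lemma opsys_mx_spanning : exists d (b : 'I_d -> hmat A n),
  (forall l, opsys_mx S (b l)) /\
  forall x, opsys_mx S x -> exists r : 'I_d -> R, x = \sum_l r l *: b l.
Proof.
have [q [s [Ss sP]]] := Sfin.
have [S0 SP] := opsys_subspace Sop.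
have SZ c a : S a -> S (c *: a) by move=> Sa; rewrite -[_ *: a]addr0; exact: SP.
pose I := ('I_n * 'I_n * 'I_q * bool)%type.
pose bas (x : I) : hmat A n := let: (i, j, k, t) := x in
  hmat_elt i j (if t then 'i%C *: s k else s k).
pose b (l : 'I_#|{: I}|) := bas (enum_val l).
exists #|{: I}|, b; split.
  move=> l; rewrite /b; case: (enum_val l) => [[[i j] k] t] i' j'.
  by rewrite /bas /hmat_elt; case: ifP => // _; case: t => //; exact: SZ.
pose T x := exists r : 'I_#|{: I}| -> R, x = \sum_l r l *: b l.
have T0 : T 0 by exists (fun=> 0); rewrite big1// => l _; rewrite scale0r.
have TD x y : T x -> T y -> T (x + y).
  move=> [r ->] [r' ->]; exists (fun l => r l + r' l).
  by rewrite -big_split/=; apply: eq_bigr => l _; rewrite scalerDl.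
have TZ (c : R) x : T x -> T (c *: x).
  move=> [r ->]; exists (fun l => c * r l).
  by rewrite scaler_sumr; apply: eq_bigr => l _; rewrite scalerA.
have Tb x : T (bas x).
  exists (fun l => (l == enum_rank x)%:R); rewrite (bigD1 (enum_rank x))//= eqxx scale1r.
  by rewrite /b enum_rankK big1 ?addr0// => l /negbTE ->; rewrite scale0r.
move=> x Sx; apply: (_ : T x); rewrite [x]hmat_sum_elt.
apply: (big_ind T) => // i _; apply: (big_ind T) => // j _.
have [c ->] := sP _ (Sx i j).
have -> : hmat_elt i j (\sum_k c k *: s k) = \sum_k hmat_elt i j (c k *: s k).
  apply: hmatP => k l; rewrite !fct_sumE /hmat_elt; case: ifP => // _.
  by rewrite big1.
apply: (big_ind T) => // k _.
have -> : hmat_elt i j (c k *: s k) =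
    complex.Re (c k) *: bas (i, j, k, false) + complex.Im (c k) *: bas (i, j, k, true).
  apply: hmatP => k' l'; rewrite hmat_addE !hmat_scaleE /bas /hmat_elt; case: ifP => _.
    by rewrite scalerA -scalerDl {1}[c k]complexE [X in _ + X]mulrC.
  by rewrite !scaler0 addr0.
by apply: TD; exact: TZ.
Qed.

Lemma ucp_pure_extension : exists m (t : 'I_m -> R) (G : 'I_m -> {scalar hmat A n})
  (F : {scalar hmat A n}),
  [/\ forall k, 0 <= t k, forall k, pure (@hmat_cone R A n) (@hmat_unit R A n) (G k),
      forall x, F x = \sum_k t k * G k x &
      forall x, opsys_mx S x -> complexify F x = ucp_form phi e x].
Proof.
have [d [b [Sb bP]]] := opsys_mx_spanning.
pose f x := complex.Re (ucp_form phi e x).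
have fP (r : R) x y : opsys_mx S x -> opsys_mx S y -> f (r *: x + y) = r * f x + f y.
  move=> Sx Sy; rewrite /f (ucp_form_linear e phi_ucp r%:C%C Sx Sy).
  by rewrite raddfD/=; case: (ucp_form _ _ x) => u v; simpc.
have S00 : opsys_mx S (0 : hmat A n) by exact: (opsys_mx0 Sop).
have fsum (r : 'I_d -> R) : opsys_mx S (\sum_l r l *: b l) /\
    f (\sum_l r l *: b l) = \sum_l r l * f (b l).
  elim/big_rec2: _ => [|l y x _ [Sx fx]].
    split=> //; have := fP (-1) _ _ S00 S00.
    by rewrite scaler0 addr0 mulN1r addNr.
  by split; [exact: (opsys_mxP Sop (r l)%:C%C)|rewrite fP// fx].
have [|c Qc|m [t [G [t0 Gpure wE]]]] := @pure_decomposition R (hmat A n) (@hmat_cone R A n)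
    (@hmat_unit R A n) d b (fun l => f (b l)) (hmat_order_unit A n).
- by apply: bP; exact: opsys_mx_unit Sop.
- have [Sx <-] := fsum c; exact: Re_ucp_form_ge0 Sx Qc.
have Fs : scalar (fun x => \sum_k t k * G k x).
  move=> a x y; rewrite mulr_sumr -big_split/=; apply: eq_bigr => k _.
  by rewrite linearP/= mulrDr mulrCA.
exists m, t, G, (scalar_of Fs); split=> // x Sx.
(* Only real parts were decomposed. Since [M_n(S)] is stable under multiplication by ['i], agreement
   of real parts on it gives agreement of the complex functionals. *)
have Ff y : opsys_mx S y -> scalar_of Fs y = f y.
  move=> /bP[r ->]; rewrite (fsum r).2 linear_sum; apply: eq_bigr => l _.
  by transitivity (r l * scalar_of Fs (b l)); [exact: linearZ|rewrite [f _]wE].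
rewrite /complexify Ff// Ff; last exact: opsys_mx_scale.
rewrite /f (ucp_form_scale e Sop phi_ucp _ Sx); case: (ucp_form _ _ x) => u v /=.
by rewrite mul0r mul1r sub0r opprK.
Qed.

End UcpExtension.

Section Dilation.
Variables (R : realType) (A : cstarAlgType R) (S : set A) (H : hilbertType R).
Variables (phi : A -> 'B(H)) (n : nat) (e : 'I_n -> H).
Hypotheses (Sop : operator_system S) (phi_ucp : ucp S phi).
Hypothesis e_span : forall x, exists c : 'I_n -> R[i], x = \sum_j c j *: e j.
Variables (K : hilbertType R) (pi : A -> 'B(K)) (xi : 'I_n -> K).
Hypothesis repr : representation pi.
Hypothesis xiE : forall a i j, S a -> '[pi a (xi j), xi i] = '[phi a (e j), e i].

Let L (c : 'I_n -> R[i]) := \sum_j c j *: xi j.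
Let E (c : 'I_n -> R[i]) := \sum_j c j *: e j.

Let LE a c d : S a -> '[pi a (L c), L d] = '[phi a (E c), E d].
Proof.
move=> Sa.
have -> : pi a (L c) = \sum_j c j *: pi a (xi j).
  by rewrite linear_sum; apply: eq_bigr => j _; rewrite linearZ.
have -> : phi a (E c) = \sum_j c j *: phi a (e j).
  by rewrite linear_sum; apply: eq_bigr => j _; rewrite linearZ.
rewrite !hdotE !sform_sumr; apply: eq_bigr => i _.
rewrite !sform_suml; apply: eq_bigr => j _.
by rewrite !sformZl !sformZr -!hdotE xiE.
Qed.

Let L_iso c d : '[L c, L d] = '[E c, E d].
Proof.
by have := LE c d (opsys_one Sop); rewrite (repr_one repr) (ucp_one phi_ucp).
Qed.

Let L_eq c d : E c = E d -> L c = L d.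
Proof.
move=> cd; apply/eqP; rewrite -subr_eq0; apply/eqP/hdot_eq0.
by rewrite hdotE sformBl !sformBr -!hdotE !L_iso cd !subrr.
Qed.

Let L_linear a c d : L (fun j => a * c j + d j) = a *: L c + L d.
Proof.
rewrite /L scaler_sumr -big_split/=; apply: eq_bigr => j _.
by rewrite scalerDl scalerA.
Qed.

Let E_linear a c d : E (fun j => a * c j + d j) = a *: E c + E d.
Proof.
rewrite /E scaler_sumr -big_split/=; apply: eq_bigr => j _.
by rewrite scalerDl scalerA.
Qed.

(** At the unit of [A], [xiE] says that the [xi j] and the [e j] have the same Gram matrix, so
    sending [E c] to [L c] is well defined and isometric even for dependent [e]. For [s] in [S],
    [xiE] makes [pi s (V x) - V (phi s x)] orthogonal to the range of [V]. *)
Lemma dilation_from_vectors : exists (V : {linear H -> K}) (P : 'B(K)),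
  [/\ forall x y, '[V x, V y] = '[x, y], orth_proj (range V) P &
      forall s x, S s -> V (phi s x) = P (pi s (V x))].
Proof.
have [c cE] := choice e_span.
have EcE x : E (c x) = x by rewrite /E -cE.
have Vlin : linear (fun x => L (c x)).
  by move=> a x y; rewrite -L_linear; apply: L_eq; rewrite E_linear !EcE.
pose V : {linear H -> K} := HB.pack (fun x => L (c x)) (GRing.isLinear.Build _ _ _ _ _ Vlin).
have VE x : V x = L (c x) by [].
have V_iso x y : '[V x, V y] = '[x, y] by rewrite !VE L_iso !EcE.
have rV : Defs.subspace (range V).
  split; first by exists 0 => //; rewrite linear0.
  by move=> a _ _ [x _ <-] [y _ <-]; exists (a *: x + y) => //; rewrite linearP.
have [|P PV] := orth_proj_exists rV.
  move=> y; have [d dP] := finite_projection xi y.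
  exists (L d); first by exists (E d) => //; rewrite VE; apply: L_eq; rewrite EcE.
  move=> _ [z _ <-]; rewrite VE hdotE sform_sumr big1// => i _.
  by rewrite sformZr -hdotE dP mulr0.
exists V, P; split=> // s x Ss; apply/esym/(orth_proj_eq rV PV); first by exists (phi s x).
move=> _ [z _ <-]; rewrite hdotE sformBl -!hdotE V_iso !VE LE// !EcE.
by rewrite subrr.
Qed.

End Dilation.

Theorem theorem1p5 (R : realType) (A : cstarAlgType R) (S : set A)
    (H : hilbertType R) (phi : A -> 'B(H)) :
  fdi A -> operator_system S -> finite_dim S ->
  finite_dim [set: H] -> ucp S phi ->
  exists (K : hilbertType R) (V : {linear H -> K}) (P : 'B(K))
      (pi : A -> 'B(K)),
    [/\ finite_dim [set: K],
        forall x y : H, '[V x, V y] = '[x, y],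
        orth_proj (range V) P,
        representation pi &
        forall (s : A) (x : H), S s -> V (phi s x) = P (pi s (V x))].
Proof.
move=> Afdi Sop Sfin [n [e [_ eP]]] phi_ucp.
have [m [t [G [F [t0 Gpure FE Fphi]]]]] := ucp_pure_extension e Sop phi_ucp Sfin.
have Kfin := finite_dim_gns Afdi t0 Gpure FE.
set Fpos := pure_sum_positive t0 Gpure FE in Kfin.
have [pi piE] := gns_rep_exists Fpos.
have repr := gns_representation piE.
have phi0 z : phi 0 z = 0.
  have [S0 _] := opsys_subspace Sop.
  have := ucp_linear phi_ucp (-1) z S0 S0; rewrite scaler0 addr0 scaleN1r.
  by rewrite addNr.
have xiE a i j : S a -> '[pi a (gns_basis Fpos j), gns_basis Fpos i] = '[phi a (e j), e i].
  move=> Sa; rewrite (gns_form_elt piE) Fphi.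
    rewrite /ucp_form (bigD1 i)//= [X in _ + X]big1 ?addr0; last first.
      move=> k /negbTE ki; rewrite big1// => l _.
      by rewrite /hmat_elt ki phi0 hdotE sform0l.
    rewrite (bigD1 j)//= [X in _ + X]big1 ?addr0; last first.
      by move=> l /negbTE lj; rewrite /hmat_elt lj andbF phi0 hdotE sform0l.
    by rewrite /hmat_elt !eqxx.
  move=> k l; rewrite /hmat_elt; case: ifP => // _.
  by have [] := opsys_subspace Sop.
have [V [P [V_iso PV VP]]] := dilation_from_vectors Sop phi_ucp (fun x => eP x I) repr xiE.
by exists (completion (gns Fpos)), V, P, pi.
Qed.
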